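(* Let $H_{[k]}(t)$, $\beta_{[k]}(t)$, $\hat\beta_{[k]}(t)$ be the matrices associated with the deformed measure $e^{t(z)}d\mu$ on $\mathbb{T}^D$ at admissible times. For $a,b\in\{\pm1,\dots,\pm D\}$ (terms involving negative block indices being absent) the matrices $H_{[k]}$ satisfy the Toda lattice type equations $$\frac{\partial}{\partial t_b}\Big(\frac{\partial H_{[k]}}{\partial t_a}H_{[k]}^{-1}\Big)=(\Upsilon_a)_{[k],[k+1]}H_{[k+1]}(\Upsilon_b)_{[k+1],[k]}H_{[k]}^{-1}-H_{[k]}(\Upsilon_b)_{[k],[k-1]}H_{[k-1]}^{-1}(\Upsilon_a)_{[k-1],[k]},$$ which can be rewritten for the rectangular matrices $\beta_{[k]}$ as $$\frac{\partial^2\beta_{[k]}}{\partial t_a\partial t_b}=\frac{\partial}{\partial t_a}\big(\beta_{[k]}(\Upsilon_b)_{[k-1],[k]}\beta_{[k]}\big)-\frac{\partial\beta_{[k]}}{\partial t_a}\beta_{[k-1]}(\Upsilon_b)_{[k-2],[k-1]}-(\Upsilon_b)_{[k],[k+1]}\beta_{[k+1]}\frac{\partial\beta_{[k]}}{\partial t_a},$$ and for the $\hat\beta_{[k]}$ as $$\frac{\partial^2\hat\beta_{[k]}}{\partial\bar t_{-a}\partial\bar t_{-b}}=\frac{\partial}{\partial\bar t_{-a}}\big(\hat\beta_{[k]}(\Upsilon_b)_{[k-1],[k]}\hat\beta_{[k]}\big)-\frac{\partial\hat\beta_{[k]}}{\partial\bar t_{-a}}\hat\beta_{[k-1]}(\Upsilon_b)_{[k-2],[k-1]}-(\Upsilon_b)_{[k],[k+1]}\hat\beta_{[k+1]}\frac{\partial\hat\beta_{[k]}}{\partial\bar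 t_{-a}}.$$
   Context: Let $D\ge1$, $z(\theta)=(e^{i\theta_1},\dots,e^{i\theta_D})$. For $\alpha\in\mathbb{Z}^D$ put $|\alpha|=\sum_a|\alpha_a|$, $z^\alpha=\prod_a z_a^{\alpha_a}$, $[k]=\{\alpha:|\alpha|=k\}$. Multi-indices are ordered by $|\alpha|$ and lexicographically inside each $[k]$; $\chi(z)$ is the semi-infinite column of all monomials in this order. Semi-infinite matrices have the corresponding block structure $A_{[k],[l]}$. $\mu$ is a complex Borel measure on $\mathbb{T}^D$. The times $t=(t_\alpha)_{\alpha\in\mathbb{Z}^D}$ form a family of complex parameters, $t(z)=\sum_\alpha t_\alpha z^\alpha$, and $G(t)=\oint\chi(z(\theta))e^{t(z(\theta))}d\mu(\theta)\chi(z(\theta))^\dagger$. Times are admissible if $G(t)$ admits the block Gauss–Borel factorization $G(t)=S(t)^{-1}H(t)(\hat S(t)^{-1})^\dagger$ with $S,\hat S$ block lower unitriangular and $H=\operatorname{diag}(H_{[0]},H_{[1]},\dots)$ with invertible blocks (the factorization is then unique). All times considered are assumed admissible. $\beta_{[k]}=S_{[k],[k-1]}$, $\hat\beta_{[k]}=\hat S_{[k],[k-1]}$, $k\ge1$; $S,H$ depend on the $t_\alpha$ and $\hat S$ on the conjugates $\bar t_\alpha$. For $a\in\{1,\dots,D\}$: $(\Upsilon_a)_{\beta,\gamma}=\delta_{\beta+e_a,\gamma}$, $\Upsilon_{-a}=\Upsilon_a^{-1}=\Upsilon_a^\top$, and $t_{\pm a}$ denotes the time $t_\alpha$ with $\alpha=\pm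 e_a$. *)

(* Defs.v *)
From HB Require Import structures.
From mathcomp Require Import all_boot all_order all_algebra.
From mathcomp Require Import all_classical all_reals all_analysis.
From mathcomp Require Import complex zify.

Set Implicit Arguments.
Unset Strict Implicit.
Unset Printing Implicit Defensive.

Import Order.TTheory GRing.Theory Num.Theory.
Import numFieldNormedType.Exports.

Local Open Scope classical_set_scope.
Local Open Scope ring_scope.

(* The topology and normed structure of R[i] are those of R[i]^o. *)

Definition midx (D : nat) := 'rV[int]_D.

Definition mlen (D : nat) (al : midx D) : nat := (\sum_a `|al 0%R a|)%N.

Definition lexle (D : nat) (al be : midx D) : bool :=
  (([seq al 0 a | a <- enum 'I_D] : seqlexi int)
     <= ([seq be 0 a | a <- enum 'I_D] : seqlexi int))%O.

(* The block [k], in lexicographic order; its elements all lie in the box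
   [-k, k]^D. *)
Definition level (D k : nat) : seq (midx D) :=
  sort (@lexle D)
    [seq al <- [seq (\row_a ((f a)%:Z - k%:Z)) | f : {ffun 'I_D -> 'I_k.*2.+1}]
    | mlen al == k].

Lemma mem_level (D k : nat) (al : midx D) : (al \in level D k) = (mlen al == k).
Proof.
rewrite mem_sort mem_filter; case: eqP => //= alk.
have ak a : (`|al 0%R a| <= k)%N.
  by rewrite -alk /mlen (bigD1 a) //= leq_addr.
have fP a : (`|(al 0%R a + k%:Z)%R| < k.*2.+1)%N by move: (ak a); lia.
apply/mapP; exists [ffun a => Ordinal (fP a)]; first by rewrite mem_enum.
by apply/rowP => a; rewrite mxE ffunE /=; move: (ak a); lia.
Qed.

Lemma level_uniq (D k : nat) : uniq (level D k).
Proof.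
rewrite sort_uniq filter_uniq // map_inj_uniq ?enum_uniq // => f g /rowP fg.
apply/ffunP => a; have := fg a; rewrite !mxE => /addIr [] /val_inj; exact.
Qed.

Definition levelsz (D k : nat) : nat := size (level D k).

Definition lidx (D k : nat) (i : 'I_(levelsz D k)) : midx D :=
  tnth (in_tuple (level D k)) i.

(* The torus {z in C^D : |z_a| = 1 for all a}, with the topology induced by
   C^D. *)
Definition torus_set (R : realType) (D : nat) : set 'rV[R[i]^o]_D :=
  [set z | forall a, `|z 0 a| = 1].

Definition torus (R : realType) (D : nat) : Type := set_type (@torus_set R D).

HB.instance Definition _ (R : realType) (D : nat) :=
  Topological.copy (torus R D) (set_type (@torus_set R D)).

Lemma torus_one_subproof (R : realType) (D : nat) :
  (const_mx 1 : 'rV[R[i]^o]_D) \in @torus_set R D.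
Proof. by rewrite inE => a; rewrite mxE normr1. Qed.

Definition torus_one (R : realType) (D : nat) : torus R D :=
  exist (fun z => z \in @torus_set R D) _ (@torus_one_subproof R D).

HB.instance Definition _ (R : realType) (D : nat) :=
  isPointed.Build (torus R D) (@torus_one R D).

Definition btorus (R : realType) (D : nat) :=
  g_sigma_algebraType (@open (torus R D)).



(* A complex Borel measure is a charge with values in R[i]; its real and
   imaginary parts are finite signed measures. *)
Lemma complex_part_charge d (T : measurableType d) (R : realType)
    (mu : {charge set T -> \bar R[i]}) (p : R[i] -> R)
    (pB : forall x y, p (x - y) = p x - p y)
    (p_le : forall x : R[i], (`|p x|)%:C%C <= `|x|)
    (nu := fun A : set T => (p (fine (mu A)))%:E) :
  [/\ nu set0 = 0%E, (forall A, measurable A -> nu A \is a fin_num)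
    & semi_sigma_additive nu].
Proof.
have p0 : p 0 = 0 by rewrite -(subrr 0) pB subrr.
have pN x : p (- x) = - p x by rewrite -sub0r pB p0 sub0r.
have pD x y : p (x + y) = p x + p y by rewrite -{1}(opprK y) pB pN opprK.
split; rewrite /nu.
- by rewrite charge0 /= p0.
- by [].
move=> F mF tF mUF.
have := @charge_semi_sigma_additive _ _ _ mu F mF tF mUF.
have fF i : mu (F i) \is a fin_num by exact: fin_num_measure.
have fU : mu (\bigcup_n F n) \is a fin_num by exact: fin_num_measure.
have sumE n : (\sum_(0 <= i < n) mu (F i) =
    (\sum_(0 <= i < n) fine (mu (F i)))%:E)%E.
  by rewrite -sumEFin; apply: eq_bigr => i _; rewrite fineK.
have psum n : p (\sum_(0 <= i < n) fine (mu (F i))) =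
    \sum_(0 <= i < n) p (fine (mu (F i))) by exact: (big_morph p pD p0).
move: fU; case: (mu (\bigcup_n F n)) => // l _ cF.
rewrite (_ : (fun n => _) =
    EFin \o (fun n => p (\sum_(0 <= i < n) fine (mu (F i))))); last first.
  by apply/funext => n /=; rewrite psum -sumEFin.
apply/fine_cvgP; split; first exact: nearW.
apply/cvgrPdist_lt => e e0 /=.
have /cF : nbhs (l%:E : \bar R[i]) [set x | `|l - fine x| < e%:C%C].
  by apply/nbhs_ballP; exists e%:C%C => //=; rewrite ltcR.
case=> N _ hN; exists N => // n /hN /=; rewrite sumE /= => ln.
by rewrite -pB -ltcR; apply: le_lt_trans ln; exact: p_le.
Qed.

Definition re_part d (T : measurableType d) (R : realType)
    (mu : {charge set T -> \bar R[i]}) : set T -> \bar R :=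
  fun A => (complex.Re (fine (mu A)))%:E.

Definition im_part d (T : measurableType d) (R : realType)
    (mu : {charge set T -> \bar R[i]}) : set T -> \bar R :=
  fun A => (complex.Im (fine (mu A)))%:E.

Lemma re_part_charge d (T : measurableType d) (R : realType)
    (mu : {charge set T -> \bar R[i]}) :
  [/\ re_part mu set0 = 0%E,
      (forall A, measurable A -> re_part mu A \is a fin_num)
    & semi_sigma_additive (re_part mu)].
Proof.
apply: complex_part_charge => [[a b] [c e]|[a b]] //=.
rewrite lecE /= eqxx /= -sqrtr_sqr ler_wsqrtr // lerDl sqr_ge0 //.
Qed.

Lemma im_part_charge d (T : measurableType d) (R : realType)
    (mu : {charge set T -> \bar R[i]}) :
  [/\ im_part mu set0 = 0%E,
      (forall A, measurable A -> im_part mu A \is a fin_num)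
    & semi_sigma_additive (im_part mu)].
Proof.
apply: complex_part_charge => [[a b] [c e]|[a b]] //=.
rewrite lecE /= eqxx /= -sqrtr_sqr ler_wsqrtr // lerDr sqr_ge0 //.
Qed.

HB.instance Definition _ d (T : measurableType d) (R : realType)
    (mu : {charge set T -> \bar R[i]}) :=
  isCharge.Build d T R (re_part mu) (let: And3 h _ _ := re_part_charge mu in h)
    (let: And3 _ h _ := re_part_charge mu in h)
    (let: And3 _ _ h := re_part_charge mu in h).

HB.instance Definition _ d (T : measurableType d) (R : realType)
    (mu : {charge set T -> \bar R[i]}) :=
  isCharge.Build d T R (im_part mu) (let: And3 h _ _ := im_part_charge mu in h)
    (let: And3 _ h _ := im_part_charge mu in h)
    (let: And3 _ _ h := im_part_charge mu in h).

(* The integral against a signed measure is taken through its Jordan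
   decomposition, which does not depend on the Hahn decomposition chosen. *)
Section signed_integral.
Context d (T : measurableType d) (R : realType).
Variable nu : {charge set T -> \bar R}.

Lemma hahn_pair : {PN : set T * set T | hahn_decomposition nu PN.1 PN.2}.
Proof. by apply: cid; have [P [N h]] := Hahn_decomposition nu; exists (P, N). Qed.

Definition pos_var := jordan_pos (svalP hahn_pair).
Definition neg_var := jordan_neg (svalP hahn_pair).

Definition sintegrable (f : T -> R) : Prop :=
  pos_var.-integrable setT (EFin \o f) /\ neg_var.-integrable setT (EFin \o f).

Definition sintegral (f : T -> R) : R :=
  \int[pos_var]_(x in setT) f x - \int[neg_var]_(x in setT) f x.

End signed_integral.

Section complex_integral.
Context d (T : measurableType d) (R : realType).
Variable mu : {charge set T -> \bar R[i]}.
Implicit Type f : T -> R[i].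

Definition cintegrable f : Prop :=
  [/\ sintegrable (re_part mu) (fun x => complex.Re (f x)),
      sintegrable (re_part mu) (fun x => complex.Im (f x)),
      sintegrable (im_part mu) (fun x => complex.Re (f x))
    & sintegrable (im_part mu) (fun x => complex.Im (f x))].

Definition cintegral f : R[i] :=
  ((sintegral (re_part mu) (fun x => complex.Re (f x))
      - sintegral (im_part mu) (fun x => complex.Im (f x)))
   +i* (sintegral (re_part mu) (fun x => complex.Im (f x))
      + sintegral (im_part mu) (fun x => complex.Re (f x))))%C.

End complex_integral.

Definition cexp (R : realType) (w : R[i]) : R[i] :=
  let: (x +i* y)%C := w in ((expR x * cos y) +i* (expR x * sin y))%C.

Definition monomial (R : realType) (D : nat) (al : midx D) (z : torus R D)
    : R[i] :=
  \prod_(a < D) ((set_val z : 'rV[R[i]^o]_D) 0 a : R[i]) ^ (al 0 a).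

Definition times (R : realType) (D : nat) := midx D -> R[i].

(* t(z), summed along the graded order of the multi-indices. *)
Definition tpartial (R : realType) (D : nat) (t : times R D) (z : torus R D)
    (n : nat) : R[i]^o :=
  \sum_(k < n) \sum_(al <- level D k) t al * monomial al z.

Definition tsum (R : realType) (D : nat) (t : times R D) (z : torus R D)
    : R[i] :=
  limn (tpartial t z).

(* The deformed measure e^{t(z)} dmu is defined. *)
Definition deformable (R : realType) (D : nat)
    (mu : {charge set (btorus R D) -> \bar R[i]}) (t : times R D) : Prop :=
  (forall z : torus R D, cvgn (tpartial t z)) /\
  cintegrable mu (fun z => cexp (tsum t z)).

(* Semi-infinite matrices, given by their blocks A_{[k],[l]}; row i of block k
   stands for the multi-index lidx i. *)
Definition bmx (R : realType) (D : nat) :=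
  forall k l, 'M[R[i]]_(levelsz D k, levelsz D l).

Definition bmx1 (R : realType) (D : nat) : bmx R D :=
  fun k l => \matrix_(i, j) (lidx i == lidx j)%:R.

Definition lower_unitri (R : realType) (D : nat) (A : bmx R D) : Prop :=
  (forall k l, (k < l)%N -> A k l = 0) /\ (forall k, A k k = 1%:M).

(* The product AB, for A block lower triangular: its blocks are finite sums. *)
Definition lmul (R : realType) (D : nat) (A B : bmx R D) : bmx R D :=
  fun k l => \sum_(j < k.+1) A k j *m B j l.

Definition linverse (R : realType) (D : nat) (A L : bmx R D) : Prop :=
  [/\ lower_unitri L, lmul A L = @bmx1 R D & lmul L A = @bmx1 R D].

Definition adjmx (R : realType) (m n : nat) (A : 'M[R[i]]_(m, n))
    : 'M[R[i]]_(n, m) := \matrix_(i, j) (A j i)^*.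

Definition gram (R : realType) (D : nat)
    (mu : {charge set (btorus R D) -> \bar R[i]}) (t : times R D) : bmx R D :=
  fun k l => \matrix_(i, j)
    cintegral mu (fun z => monomial (lidx i) z * cexp (tsum t z)
                             * (monomial (lidx j) z)^*).

(* G = S^{-1} H (Sh^{-1})^dagger; as S^{-1} is block lower triangular and H is
   block diagonal, each block of the product is a finite sum. *)
Definition gauss_borel (R : realType) (D : nat) (G S : bmx R D)
    (H : forall k, 'M[R[i]]_(levelsz D k)) (Sh : bmx R D) : Prop :=
  [/\ lower_unitri S, lower_unitri Sh, (forall k, H k \in unitmx)
    & exists L Lh : bmx R D,
      [/\ linverse S L, linverse Sh Lh
        & forall k l,
            G k l = \sum_(j < k.+1) L k j *m H j *m adjmx (Lh l j)]].

Definition admissible (R : realType) (D : nat)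
    (mu : {charge set (btorus R D) -> \bar R[i]}) (t : times R D) : Prop :=
  deformable mu t /\ exists S H Sh, gauss_borel (gram mu t) S H Sh.

(* The signed index a in {+-1, ..., +-D}; (a, true) stands for -a. *)
Definition sindex (D : nat) := ('I_D * bool)%type.

Definition sopp (D : nat) (a : sindex D) : sindex D := (a.1, ~~ a.2).

Definition svec (D : nat) (a : sindex D) : midx D :=
  if a.2 then - delta_mx 0 a.1 else delta_mx 0 a.1.

Definition shift_pos (R : realType) (D : nat) (a : 'I_D) : bmx R D :=
  fun k l => \matrix_(i, j) (lidx i + delta_mx 0 a == lidx j)%:R.

Definition Upsilon (R : realType) (D : nat) (a : sindex D) : bmx R D :=
  fun k l => if a.2 then (shift_pos R a.1 l k)^T else shift_pos R a.1 k l.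

Definition tshift (R : realType) (D : nat) (t : times R D) (al : midx D)
    (s : R[i]) : times R D :=
  fun be => t be + (if be == al then s else 0).

Definition tderivable (R : realType) (D m n : nat) (al : midx D)
    (F : times R D -> 'M[R[i]]_(m, n)) (t : times R D) : Prop :=
  forall i j, derivable (fun s : R[i]^o => F (tshift t al s) i j : R[i]^o) 0 1.

Definition tderive (R : realType) (D m n : nat) (al : midx D)
    (F : times R D -> 'M[R[i]]_(m, n)) (t : times R D) : 'M[R[i]]_(m, n) :=
  \matrix_(i, j) 'D_1 (fun s : R[i]^o => F (tshift t al s) i j : R[i]^o) 0.

Definition tconj (R : realType) (D : nat) (t : times R D) : times R D :=
  fun al => (t al)^*.

(* d/d(conj t_al): F is differentiated as a function of the conjugate times. *)
Definition cderivable (R : realType) (D m n : nat) (al : midx D)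
    (F : times R D -> 'M[R[i]]_(m, n)) (t : times R D) : Prop :=
  tderivable al (F \o @tconj R D) (tconj t).

Definition cderive (R : realType) (D m n : nat) (al : midx D)
    (F : times R D -> 'M[R[i]]_(m, n)) (t : times R D) : 'M[R[i]]_(m, n) :=
  tderive al (F \o @tconj R D) (tconj t).

(* Main.v *)
(* Write J_a = S Upsilon_a S^{-1}. As d_a G = Upsilon_a G = G Upsilon_a, J_a is
   also conjugate to Upsilon_a through H (Sh^{-1})^dagger, hence block tridiagonal:
     (J_a)_{k,k+1} = (Upsilon_a)_{k,k+1},
     (J_a)_{k,k} = beta_k (Upsilon_a)_{k-1,k} - (Upsilon_a)_{k,k+1} beta_{k+1},
     (J_a)_{k,k-1} = H_k (Upsilon_a)_{k,k-1} H_{k-1}^{-1}.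
   Differentiating S G = H (Sh^{-1})^dagger gives d_a beta_k = - (J_a)_{k,k-1} and
   d_a H_k = (J_a)_{k,k} H_k. The equation for H_k follows at once; the one for
   beta_k also uses the block (k, k-1) of [J_a, J_b] = 0, which plays the role of
   the symmetry of mixed derivatives. The equation for the hatted beta_k is that
   of beta_k for the adjoint moment matrix, in the conjugate times. That d_a G
   exists comes from |e^w - 1 - w| = O(|w|^2), integrated against the four
   positive parts of the complex measure. *)
Require Import Defs.
From HB Require Import structures.
From mathcomp Require Import all_boot all_order all_algebra.
From mathcomp Require Import all_classical all_reals all_analysis.
From mathcomp Require Import measurable_realfun complex zify ring lra.

Set Implicit Arguments.
Unset Strict Implicit.
Unset Printing Implicit Defensive.

Import Order.TTheory GRing.Theory Num.Theory.
Import numFieldNormedType.Exports.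

Local Open Scope classical_set_scope.
Local Open Scope ring_scope.

(** * Block matrices and the three-term relation *)

Section BlockAlgebra.
Variables (F : fieldType) (d : nat -> nat).
Local Notation bmat := (forall k l, 'M[F]_(d k, d l)).

(** Semi-infinite products are replaced by products truncated at [n] blocks, which are associative
    outright; the price is an inequality keeping the rows or columns at hand away from the last
    block. The matrix [J_a] is never formed: it enters only through the coefficients that expand the
    rows of [S Upsilon_a] in the rows of [S]. Identities between rows rest on one uniqueness
    principle: a row supported in the blocks below [k] that pairs to zero with the columns of [G]
    below [k] is zero. Hence only the part of [S G] on and below the diagonal is needed; what lies
    above it survives as an unevaluated sum that cancels. Differentiability of the factors is not
    given. It is derived from the Gram-Schmidt recursion, which is rational in [G]. As conjugation
    is not complex differentiable, [Sh] is differentiated in [t] only through its adjoint. *)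

Definition bmul n (A B : bmat) : bmat := fun k l => \sum_(j < n) A k j *m B j l.

Lemma row_bmulA n m (Y : forall j, 'M[F]_(m, d j)) (A B : bmat) l :
  \sum_(i < n) Y i *m bmul n A B i l
    = \sum_(j < n) (\sum_(i < n) Y i *m A i j) *m B j l.
Proof.
under eq_bigr do rewrite mulmx_sumr.
rewrite exchange_big /=; apply: eq_bigr => j _.
by rewrite mulmx_suml; apply: eq_bigr => i _; rewrite mulmxA.
Qed.

Lemma bmulA n A B C k l : bmul n A (bmul n B C) k l = bmul n (bmul n A B) C k l.
Proof. exact: row_bmulA. Qed.

Lemma block_sum_single n m p (f : nat -> 'M[F]_(m, p)) k :
  (forall j, j != k -> f j = 0) -> (k < n)%N -> \sum_(j < n) f j = f k.
Proof.
move=> f0 kn; rewrite (bigD1 (Ordinal kn)) //= big1 ?addr0 // => j jk.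
by apply: f0; apply: contraNN jk => /eqP jk; apply/eqP/val_inj.
Qed.

Lemma block_sum_widen n n' m p (f : nat -> 'M[F]_(m, p)) :
  (n <= n')%N -> (forall j, (n <= j)%N -> f j = 0) ->
  \sum_(j < n') f j = \sum_(j < n) f j.
Proof.
move=> nn f0; rewrite -!(big_mkord xpredT) (big_cat_nat (n := n)) //=.
by rewrite [X in _ + X]big_nat [X in _ + X]big1 ?addr0 // => j /andP[nj _]; exact: f0.
Qed.

Definition banded (U : bmat) := forall k l, l != k.+1 -> k != l.+1 -> U k l = 0.

(* [dG] plays the role of both [U G] and [G U]; the truncated products agree
   with the semi-infinite ones away from the last block. *)
Definition intertwines (U G dG : bmat) :=
  [/\ banded U, (forall n k l, (k.+1 < n)%N -> bmul n U G k l = dG k l)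
    & forall n k l, (l.+1 < n)%N -> bmul n G U k l = dG k l].

(** What the factorization says once [Sh] is eliminated: [S G] is block upper triangular with
    diagonal blocks [H k]. Its blocks above the diagonal are left unspecified. *)
Definition orthogonalizes (S : bmat) (H : forall k, 'M[F]_(d k)) (G : bmat) :=
  [/\ (forall k l, (k < l)%N -> S k l = 0), (forall k, S k k = 1%:M),
      (forall k, H k \in unitmx),
      (forall n k l, (k < n)%N -> (l < k)%N -> bmul n S G k l = 0)
    & forall n k, (k < n)%N -> bmul n S G k k = H k].

Section Orthogonal.
Variables (S G : bmat) (H : forall k, 'M[F]_(d k)).
Hypothesis SHG : orthogonalizes S H G.

Let S_up k l : (k < l)%N -> S k l = 0. Proof. by case: SHG => + *; exact. Qed.
Let S_diag k : S k k = 1%:M. Proof. by case: SHG. Qed.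
Let H_unit k : H k \in unitmx. Proof. by case: SHG. Qed.
Let SG_low n k l : (k < n)%N -> (l < k)%N -> bmul n S G k l = 0.
Proof. by case: SHG => _ _ _ + _; exact. Qed.
Let SG_diag n k : (k < n)%N -> bmul n S G k k = H k.
Proof. by case: SHG => _ _ _ _; exact. Qed.

(** Induction on the number of blocks. Subtracting [Y k] times row [k] of [S] removes the last block
    and preserves the vanishing pairings, so [Y] is a left multiple of row [k] of [S]. Its pairing
    with column [k] is then [Y k *m H k], and [H k] is invertible. *)
Lemma orthogonal_row_eq0 m k (Y : forall j, 'M[F]_(m, d j)) :
  (forall l, (l < k)%N -> \sum_(j < k) Y j *m G j l = 0) ->
  forall j, (j < k)%N -> Y j = 0.
Proof.
elim: k Y => [//|k IH] Y YG.
have YS j : (j < k)%N -> Y j - Y k *m S k j = 0.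
  move: j; apply: (IH (fun j => Y j - Y k *m S k j)) => l lk.
  under eq_bigr do rewrite mulmxBl -mulmxA.
  rewrite sumrB -mulmx_sumr.
  have := YG l (ltnW lk); rewrite big_ord_recr /= => /eqP.
  rewrite addr_eq0 => /eqP ->.
  have := SG_low (ltnSn k) lk; rewrite /bmul big_ord_recr /= S_diag mul1mx.
  by move=> /eqP; rewrite addr_eq0 => /eqP ->; rewrite mulmxN opprK addNr.
have YE j : (j < k.+1)%N -> Y j = Y k *m S k j.
  rewrite ltnS leq_eqVlt => /orP[/eqP -> | /YS /eqP].
    by rewrite S_diag mulmx1.
  by rewrite subr_eq0 => /eqP.
have Yk : Y k = 0.
  have := YG k (ltnSn k).
  under eq_bigr => j _ do rewrite (YE j) // -mulmxA.
  rewrite -mulmx_sumr -/(bmul k.+1 S G k k) SG_diag // => YH.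
  by rewrite -(mulmxK (H_unit k) (Y k)) YH mul0mx.
by move=> j jk; rewrite YE // Yk mul0mx.
Qed.

(** The block [(p.+1, p)] of [S U S^{-1}]; indexing it by the lower block avoids a case at the
    boundary. *)
Definition lowcoef (U : bmat) p := H p.+1 *m U p.+1 p *m invmx (H p).

(* The coefficients of the three-term relation
   [(S U)_k = U_{k,k+1} S_{k+1} + diagcoef_k S_k + lowcoef_k S_{k-1}]. *)
Definition diagcoef (U : bmat) k : 'M[F]_(d k) :=
  match k return 'M[F]_(d k) with
  | 0 => 0
  | p.+1 => S p.+1 p *m U p p.+1
  end - U k k.+1 *m S k.+1 k.

(** A whole row is kept because its negative turns out to be the derivative of row [k] of [S]. *)
Definition lowrow (U : bmat) k j : 'M[F]_(d k, d j) :=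
  match k return 'M[F]_(d k, d j) with
  | 0 => 0
  | p.+1 => lowcoef U p *m S p j
  end.

Section ThreeTerm.
Variables (U dG : bmat).
Hypothesis UG : intertwines U G dG.

Let Uband : banded U. Proof. by case: UG. Qed.

(** As [dG = G U], this is a block of [(S G) U]. To the left of the diagonal [S G] vanishes, and its
    unknown part to the right meets zero blocks of the banded [U]; only [H k] is left. *)
Lemma S_dG_low n k l : (k < n)%N -> (l < k)%N -> bmul n S dG k l = H k *m U k l.
Proof.
move=> kn lk; case: UG => _ _ GU.
rewrite /bmul (eq_bigr (fun j : 'I_n => S k j *m bmul n G U j l)); last first.
  by move=> j _; rewrite GU //; lia.
rewrite row_bmulA (block_sum_single (k := k)
  (f := fun j => (\sum_(i < n) S k i *m G i j) *m U j l)) //.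
  by rewrite -/(bmul n S G k k) SG_diag.
move=> j; rewrite -/(bmul n S G k j).
case: (ltngtP j k) => // jk _; first by rewrite SG_low ?mul0mx.
by rewrite Uband ?mulmx0 //; lia.
Qed.

Lemma lowrow_G_low n k l : (k < n)%N -> (l < k)%N ->
  \sum_(j < n) lowrow U k j *m G j l = H k *m U k l.
Proof.
case: k => [|p] // pn; rewrite ltnS leq_eqVlt => lp /=.
under eq_bigr do rewrite -mulmxA.
rewrite -mulmx_sumr -/(bmul n S G p l); case/orP: lp => [/eqP -> | lp].
  by rewrite (SG_diag (ltnW pn)) mulmxKV // H_unit.
by rewrite (SG_low (ltnW pn) lp) mulmx0 Uband ?mulmx0 //; lia.
Qed.

Lemma S_U_dG n k l : (k.+1 < n)%N ->
  \sum_(j < n) bmul n S U k j *m G j l = bmul n S dG k l.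
Proof.
move=> kn; rewrite -[LHS]bmulA; case: UG => _ GU _; apply: eq_bigr => i _.
case: (leqP i k) => ik; first by rewrite GU //; lia.
by rewrite S_up // !mul0mx.
Qed.

(** In the blocks [j >= k] the band structure decides. The difference of the two sides is thus
    supported below [k] and pairs to zero with the columns of [G] below [k], so [orthogonal_row_eq0]
    kills it. *)
Lemma three_term n k j : (k < n)%N ->
  bmul n S U k j = U k k.+1 *m S k.+1 j + diagcoef U k *m S k j + lowrow U k j.
Proof.
(* Row [k] of [S U] is the same for every truncation beyond [k]; [k.+3] also leaves room to pair row
   [k.+1] of [S] with [G]. *)
move=> kn; have -> : bmul n S U k j = bmul k.+3 S U k j.
  rewrite /bmul (block_sum_widen (n := k.+1) (f := fun i => S k i *m U i j)) //; last first.
    by move=> i ki; rewrite S_up ?mul0mx.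
  rewrite [RHS](block_sum_widen (n := k.+1) (f := fun i => S k i *m U i j)) //; first by lia.
  by move=> i ki; rewrite S_up ?mul0mx.
have lowrow0 i : (k <= i)%N -> lowrow U k i = 0.
  by case: k kn => [|p] // pn pi /=; rewrite S_up ?mulmx0.
have SUbig i : (k <= i)%N ->
  bmul k.+3 S U k i = U k k.+1 *m S k.+1 i + diagcoef U k *m S k i + lowrow U k i.
  move=> ki; rewrite lowrow0 // addr0 /bmul.
  case: (ltngtP i k.+1) => ik.
  - have -> : i = k by lia.
    (* The second term of [diagcoef] is there to cancel the contribution of row [k.+1] of [S] to
       block [k]. *)
    rewrite S_diag mulmx1 /diagcoef addrCA subrr addr0.
    case: (k) => [|p].
      rewrite big1 // => -[[|m] mn] _ /=; first by rewrite Uband ?mulmx0.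
      by rewrite S_up ?mul0mx.
    rewrite (block_sum_single (k := p) (f := fun i => S p.+1 i *m U i p.+1)) //; last by lia.
    move=> m mp; case: (leqP m p.+1) => mp1; last by rewrite S_up ?mul0mx.
    by rewrite Uband ?mulmx0 //; lia.
  - rewrite !S_up // ?mulmx0 ?addr0; last by lia.
    rewrite big1 // => m _; case: (leqP m k) => mk; last by rewrite S_up ?mul0mx.
    by rewrite Uband ?mulmx0 //; lia.
  - rewrite ik S_diag mulmx1 (S_up (k := k)) // mulmx0 addr0.
    rewrite (block_sum_single (k := k) (f := fun i => S k i *m U i k.+1)) //; last by lia.
      by rewrite S_diag mul1mx.
    move=> m mp; case: (leqP m k) => mk; last by rewrite S_up ?mul0mx.
    by rewrite Uband ?mulmx0 //; lia.
pose Y i := bmul k.+3 S U k i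
  - (U k k.+1 *m S k.+1 i + diagcoef U k *m S k i + lowrow U k i).
case: (leqP k j) => kj; first exact: SUbig.
apply/eqP; rewrite -subr_eq0; apply/eqP.
move: j kj; apply: (orthogonal_row_eq0 (Y := Y)) => l lk.
rewrite -(block_sum_widen (n' := k.+3) (f := fun i => Y i *m G i l)); last 2 first.
- by lia.
- by move=> i ki; rewrite /Y SUbig // subrr mul0mx.
rewrite /Y; move: (diagcoef U k) => A.
under eq_bigr do rewrite mulmxBl !mulmxDl -!mulmxA.
rewrite sumrB !big_split /= -!mulmx_sumr S_U_dG // S_dG_low //; last by lia.
rewrite (lowrow_G_low (n := k.+3)) //; last by lia.
rewrite -!/(bmul _ S G _ _).
rewrite !SG_low ?mulmx0 ?add0r ?subrr //; lia.
Qed.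

(** The last sum involves [S G] above the diagonal and stays unevaluated; it cancels wherever this
    lemma is applied. *)
Lemma S_dG_diag n k : (k.+1 < n)%N ->
  bmul n S dG k k = diagcoef U k *m H k + \sum_(j < n) lowrow U k j *m G j k.
Proof.
move=> kn; rewrite -S_U_dG //.
under eq_bigr => j _ do rewrite three_term ?(ltnW kn) //.
move: (diagcoef U k) => A; under eq_bigr do rewrite !mulmxDl -!mulmxA.
rewrite !big_split /= -!mulmx_sumr -!/(bmul _ S G _ _) SG_low // SG_diag ?(ltnW kn) //.
by rewrite mulmx0 add0r.
Qed.

(* Leibniz' rule for [S G], the derivatives of [S], [G], [H] being [X], [dG],
   [K]. *)
Lemma toda_first_order (X : bmat) (K : forall k, 'M[F]_(d k)) :
  (forall k j, (k <= j)%N -> X k j = 0) ->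
  (forall n k l, (k < n)%N -> (l < k)%N -> bmul n X G k l + bmul n S dG k l = 0) ->
  (forall n k, (k < n)%N -> bmul n X G k k + bmul n S dG k k = K k) ->
  (forall k j, X k j = - lowrow U k j) /\ (forall k, K k = diagcoef U k *m H k).
Proof.
move=> X0 Xlow Xdiag.
have XE k j : X k j = - lowrow U k j.
  have big0 i : (k <= i)%N -> X k i + lowrow U k i = 0.
    move=> ki; rewrite X0 // add0r.
    by case: k ki => [|p] // pi /=; rewrite S_up ?mulmx0.
  apply/eqP; rewrite -addr_eq0; apply/eqP.
  case: (leqP k j) => kj; first exact: big0.
  (* Left of the diagonal, [lowrow G] and [S dG] both equal [H k *m U k l], so the hypothesis on [X]
     says that [X + lowrow] pairs to zero with [G]. *)
  move: j kj; apply: (orthogonal_row_eq0 (Y := fun j => X k j + lowrow U k j)) => l lk.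
  rewrite -(block_sum_widen (n' := k.+1) (f := fun i => (X k i + lowrow U k i) *m G i l)) //.
    under eq_bigr do rewrite mulmxDl.
    rewrite big_split /= lowrow_G_low //.
    by rewrite -(S_dG_low (ltnSn k)) // [LHS]Xlow.
  by move=> i ki; rewrite big0 ?mul0mx.
(* The unevaluated sum of [S_dG_diag] cancels against [X G], because [X = - lowrow]. *)
split=> // k; rewrite -(Xdiag k.+2) // S_dG_diag // addrCA /bmul.
rewrite -[X in _ + X]big_split big1 /= ?addr0 // => i _.
by rewrite XE mulNmx addNr.
Qed.

End ThreeTerm.

(* The compatibility [S (U V) = S (V U)] in block column [k], paired with [G]. *)
Lemma toda_symmetry (U V dU dV : bmat) k :
  intertwines U G dU -> intertwines V G dV ->
  (forall n i j, (i.+1 < n)%N -> bmul n U V i j = bmul n V U i j) ->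
  diagcoef U k.+1 *m lowcoef V k + lowcoef U k *m diagcoef V k
    = diagcoef V k.+1 *m lowcoef U k + lowcoef V k *m diagcoef U k.
Proof.
move=> UG VG UVC; pose n := k.+4.+1.
have [kn0 kn1 kn2 kn3] : [/\ (k < n), (k.+1 < n), (k.+2 < n) & (k.+3 < n)]%N.
  by split; rewrite /n; lia.
have bandE (A : bmat) i j : banded A -> (i.+1 < j)%N -> A i j = 0.
  by move=> bA ij; apply: bA; lia.
(* Row [k.+1] of [S A] is expanded by the three-term relation and paired with column [k] of [dB].
   The [S k.+2] term drops out by bandedness, and the [S k] term leaves the unevaluated sum. *)
have key (A B dA dB : bmat) : intertwines A G dA -> intertwines B G dB ->
   bmul n S (bmul n A dB) k.+1 k
     = (diagcoef A k.+1 *m lowcoef B k + lowcoef A k *m diagcoef B k) *m H k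
       + lowcoef A k *m \sum_(j < n) lowrow B k j *m G j k.
  move=> AG BG; have [bB _ _] := BG.
  rewrite bmulA {1}/bmul.
  under eq_bigr => j _ do rewrite (three_term AG _ kn1).
  move: (diagcoef A k.+1) => A'; rewrite /=.
  under eq_bigr do rewrite !mulmxDl -!mulmxA.
  rewrite !big_split /= -!mulmx_sumr -!/(bmul _ S _ _ _).
  rewrite (S_dG_low BG) // (S_dG_low BG) // (bB k.+2 k) ?mulmx0 ?add0r; try lia.
  rewrite (S_dG_diag BG) //; move: (diagcoef B k) => B'.
  rewrite /lowcoef !mulmxDr !mulmxDl -!mulmxA mulVmx ?H_unit // mulmx1.
  by rewrite addrA.
have keysym : bmul n S (bmul n U dV) k.+1 k = bmul n S (bmul n V dU) k.+1 k.
  have expand (A B dA dB : bmat) : intertwines A G dA -> intertwines B G dB ->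
      bmul n S (bmul n A dB) k.+1 k = bmul n S (bmul n (bmul n A B) G) k.+1 k.
    move=> [bA _ _] [_ BG _]; apply: eq_bigr => i _.
    case: (leqP i k.+1) => ik; last by rewrite S_up ?mul0mx.
    rewrite -bmulA; congr (_ *m _); apply: eq_bigr => j _.
    case: (leqP j i.+1) => ij; last by rewrite bandE ?mul0mx.
    by rewrite BG //; apply: leq_trans kn3; rewrite !ltnS (leq_trans ij).
  rewrite (expand _ _ _ _ UG VG) (expand _ _ _ _ VG UG); apply: eq_bigr => i _.
  case: (leqP i k.+1) => ik; last by rewrite S_up ?mul0mx.
  by congr (_ *m _); apply: eq_bigr => j _; rewrite UVC // (leq_trans _ kn2).
(* The product of two consecutive low coefficients telescopes to [H U V H^{-1}], where by bandedness
   [U V] is a single block two steps below the diagonal; commutation of [U] and [V] applies to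
   it. *)
have tail : lowcoef U k *m \sum_(j < n) lowrow V k j *m G j k
          = lowcoef V k *m \sum_(j < n) lowrow U k j *m G j k.
  have [[bU _ _] [bV _ _]] := (UG, VG).
  rewrite !mulmx_sumr; apply: eq_bigr => j _; rewrite !mulmxA; congr (_ *m _).
  move: (nat_of_ord j) => {}j; clear -H_unit bU bV UVC.
  case: k => [|p] /=; first by rewrite !mulmx0.
  rewrite /lowcoef !mulmxA; congr (_ *m _).
  rewrite !(mulmxKV (H_unit p.+1)); congr (_ *m _); rewrite -!mulmxA; congr (_ *m _).
  have := UVC p.+4 p.+2 p (ltnSn _).
  rewrite /bmul (block_sum_single (k := p.+1) (f := fun i => U p.+2 i *m V i p)) //; last 2 first.
  - by move=> i ip; case: (ltngtP i p.+1) (ip) => // h _;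
      [rewrite bU ?mul0mx // | rewrite bV ?mulmx0 //]; lia.
  - by lia.
  rewrite (block_sum_single (k := p.+1) (f := fun i => V p.+2 i *m U i p)) //; last 2 first.
  - by move=> i ip; case: (ltngtP i p.+1) (ip) => // h _;
      [rewrite bV ?mul0mx // | rewrite bU ?mulmx0 //]; lia.
  by lia.
have := key _ _ _ _ UG VG; rewrite keysym (key _ _ _ _ VG UG) tail => /addIr HH.
by rewrite -[LHS](mulmxK (H_unit k)) -[RHS](mulmxK (H_unit k)) HH.
Qed.

End Orthogonal.
End BlockAlgebra.

(** * Gauss-Borel factorization *)

Section GaussBorel.
Variables (R : realType) (D : nat).
Implicit Types (A B G S Sh L Lh : bmx R D).
Implicit Types H : forall k, 'M[R[i]]_(levelsz D k).

Lemma lidx_inj k : injective (@lidx D k).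
Proof. exact/tuple_uniqP/level_uniq. Qed.

Lemma mlen_lidx k (i : 'I_(levelsz D k)) : mlen (lidx i) = k.
Proof. by apply/eqP; rewrite -mem_level mem_tnth. Qed.

Lemma bmx1_diag k : @bmx1 R D k k = 1%:M.
Proof. by apply/matrixP => i j; rewrite !mxE (inj_eq (@lidx_inj k)). Qed.

Lemma bmx1_offdiag k l : k != l -> @bmx1 R D k l = 0.
Proof.
move=> kl; apply/matrixP => i j; rewrite !mxE; case: eqP => // ij.
by move: kl; rewrite -(mlen_lidx i) ij mlen_lidx eqxx.
Qed.

Lemma adjmxE m n (A : 'M[R[i]]_(m, n)) : adjmx A = (map_mx Num.conj A)^T.
Proof. by apply/matrixP => i j; rewrite !mxE. Qed.

Lemma adjmxK m n (A : 'M[R[i]]_(m, n)) : adjmx (adjmx A) = A.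
Proof. by apply/matrixP => i j; rewrite !mxE conjCK. Qed.

Lemma adjmxM m n p (A : 'M[R[i]]_(m, n)) (B : 'M[R[i]]_(n, p)) :
  adjmx (A *m B) = adjmx B *m adjmx A.
Proof. by rewrite !adjmxE map_mxM trmx_mul. Qed.

Lemma adjmx0 m n : adjmx (0 : 'M[R[i]]_(m, n)) = 0.
Proof. by rewrite adjmxE map_mx0 trmx0. Qed.

Lemma adjmx1 n : adjmx (1%:M : 'M[R[i]]_n) = 1%:M.
Proof. by rewrite adjmxE map_mx1 trmx1. Qed.

Lemma adjmxD m n (A B : 'M[R[i]]_(m, n)) : adjmx (A + B) = adjmx A + adjmx B.
Proof. by rewrite !adjmxE map_mxD linearD. Qed.

Lemma adjmxB m n (A B : 'M[R[i]]_(m, n)) : adjmx (A - B) = adjmx A - adjmx B.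
Proof. by rewrite !adjmxE map_mxB linearB. Qed.

Lemma adjmx_inv n (A : 'M[R[i]]_n) : adjmx (invmx A) = invmx (adjmx A).
Proof. by rewrite !adjmxE map_invmx trmx_inv. Qed.

Lemma adjmx_sum m n (I : Type) (r : seq I) (F : I -> 'M[R[i]]_(m, n)) :
  adjmx (\sum_(i <- r) F i) = \sum_(i <- r) adjmx (F i).
Proof. exact: (big_morph _ (@adjmxD m n) (@adjmx0 m n)). Qed.

Lemma unitmx_adj n (A : 'M[R[i]]_n) : (adjmx A \in unitmx) = (A \in unitmx).
Proof. by rewrite adjmxE unitmx_tr map_unitmx. Qed.

Lemma lmulE n A B k l :
  (forall k l, (k < l)%N -> A k l = 0) -> (k < n)%N -> lmul A B k l = bmul n A B k l.
Proof.
move=> A0 kn; rewrite /bmul (block_sum_widen (n := k.+1) (f := fun j => A k j *m B j l)) //.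
by move=> j kj; rewrite A0 // mul0mx.
Qed.

Definition badj (G : bmx R D) : bmx R D := fun k l => adjmx (G l k).

Lemma gauss_borel_prod G H L Lh n k l :
  lower_unitri L ->
  (forall k l, G k l = \sum_(j < k.+1) L k j *m H j *m adjmx (Lh l j)) ->
  (k < n)%N -> G k l = \sum_(j < n) L k j *m H j *m adjmx (Lh l j).
Proof.
move=> [L0 _] -> kn; apply/esym.
apply: (block_sum_widen (f := fun j => L k j *m H j *m adjmx (Lh l j))) => // j kj.
by rewrite L0 // !mul0mx.
Qed.

(** Taking adjoints of the factorization exchanges [S] and [Sh]; this is how every statement on [S]
    is carried over to [Sh]. *)
Lemma gauss_borel_adj G S H Sh : gauss_borel G S H Sh ->
  gauss_borel (badj G) Sh (fun k => adjmx (H k)) S.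
Proof.
move=> [S1 Sh1 Hu [L [Lh [[L1 SL LS] [Lh1 ShL LSh] GE]]]].
split=> // [k|]; first by rewrite unitmx_adj.
exists Lh, L; split=> // k l; rewrite /badj.
have term0 j : (minn k l < j)%N -> Lh k j *m adjmx (H j) *m adjmx (L l j) = 0.
  case: Lh1 L1 => Lh0 _ [L0 _]; rewrite gtn_min => /orP[kj | lj].
    by rewrite Lh0 // !mul0mx.
  by rewrite L0 // adjmx0 mulmx0.
rewrite GE adjmx_sum.
(* The two factorizations truncate at [l] and at [k] respectively; by triangularity of both inverses
   the terms stop at the minimum. *)
transitivity (\sum_(j < (minn k l).+1) Lh k j *m adjmx (H j) *m adjmx (L l j)).
  rewrite -(block_sum_widen (n' := l.+1)
    (f := fun j => Lh k j *m adjmx (H j) *m adjmx (L l j))) // ?ltnS ?geq_minr //.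
  by apply: eq_bigr => j _; rewrite !adjmxM adjmxK mulmxA.
by apply/esym/(block_sum_widen
    (f := fun j => Lh k j *m adjmx (H j) *m adjmx (L l j))); rewrite ?ltnS ?geq_minl.
Qed.

(** [S G = H Lh^dagger], where [Lh^dagger] is block upper unitriangular. *)
Lemma gauss_borel_orthogonalizes G S H Sh :
  gauss_borel G S H Sh -> orthogonalizes S H G.
Proof.
move=> [[S0 Sd] _ Hu [L [Lh [[L1 SL LS] [[Lh0 Lhd] _ _] GE]]]].
have SGE n k l : (k < n)%N -> bmul n S G k l = H k *m adjmx (Lh l k).
  move=> kn; transitivity (bmul n S (bmul n L (fun i l => H i *m adjmx (Lh l i))) k l).
    apply: eq_bigr => j _; rewrite [G j l](gauss_borel_prod l L1 GE (ltn_ord j)).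
    by congr (_ *m _); apply: eq_bigr => i _; rewrite mulmxA.
  rewrite bmulA /bmul (block_sum_single (k := k) (f := fun j =>
    bmul n S L k j *m (H j *m adjmx (Lh l j)))) //.
    by rewrite -lmulE // SL bmx1_diag mul1mx.
  by move=> j jk; rewrite -lmulE // SL bmx1_offdiag ?mul0mx // eq_sym.
split=> // [n k l kn lk|n k kn]; rewrite SGE //.
  by rewrite Lh0 // adjmx0 mulmx0.
by rewrite Lhd adjmx1 mulmx1.
Qed.

(* Gram-Schmidt: [L_{ki} = (G (Sh)^dagger)_{ki} H_i^{-1}] in [L S = 1]. *)
Lemma gauss_borel_rec G S H Sh k j : gauss_borel G S H Sh ->
  S k j = @bmx1 R D k j - \sum_(i < k)
    (\sum_(m < i.+1) G k m *m adjmx (Sh i m)) *m invmx (H i) *m S i j.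
Proof.
move=> [[S0 Sd] [Sh0 Shd] Hu [L [Lh [[[L0 Ld] SL LS] [Lh1 ShL LSh] GE]]]].
(* [G Sh^dagger = L H (Sh Lh)^dagger = L H]. *)
have LE i : \sum_(m < i.+1) G k m *m adjmx (Sh i m) = L k i *m H i.
  under eq_bigr => m _ do rewrite GE mulmx_suml.
  rewrite exchange_big /=.
  under eq_bigr => p _ do (under eq_bigr do rewrite -mulmxA -adjmxM;
    rewrite -mulmx_sumr -adjmx_sum -/(lmul Sh Lh i p) ShL).
  case: (leqP i k) => ik; last first.
    rewrite L0 // mul0mx big1 // => p _.
    by rewrite bmx1_offdiag ?adjmx0 ?mulmx0 //; move: (ltn_ord p); lia.
  rewrite (block_sum_single (k := i) (f := fun p => L k p *m H p *m adjmx (@bmx1 R D i p))) //.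
    by rewrite bmx1_diag adjmx1 mulmx1.
  by move=> p pi; rewrite bmx1_offdiag ?adjmx0 ?mulmx0 // eq_sym.
rewrite -LS /lmul big_ord_recr /= Ld mul1mx addrC.
under [X in _ - X]eq_bigr => i _ do rewrite LE mulmxK //.
by rewrite addrK.
Qed.

End GaussBorel.

(** * Calculus in the times *)

Section ScalarCalculus.
Variable R : realType.
Local Notation C := R[i]^o.
Implicit Types (f g : C -> C) (x : C).

Lemma eq_derivable f g x : f =1 g -> derivable f x 1 -> derivable g x 1.
Proof. by move=> /funext ->. Qed.

Lemma eq_is_derive f g x d : f =1 g -> is_derive x 1 f d -> is_derive x 1 g d.
Proof. by move=> /funext ->. Qed.

Lemma derivable_bigsum (I : Type) (r : seq I) (P : pred I) (f : I -> C -> C) x :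
  (forall i, derivable (f i) x 1) ->
  derivable ((fun s => \sum_(i <- r | P i) f i s) : C -> C) x 1.
Proof.
move=> df; elim: r => [|i r IH].
  by apply: eq_derivable (derivable_cst 0 x 1) => s; rewrite big_nil.
case: (boolP (P i)) => Pi; last by apply: eq_derivable IH => s; rewrite big_cons (negbTE Pi).
by apply: eq_derivable (derivableD (df i) IH) => s; rewrite big_cons Pi.
Qed.

Lemma derivable_bigprod (I : Type) (r : seq I) (P : pred I) (f : I -> C -> C) x :
  (forall i, derivable (f i) x 1) ->
  derivable ((fun s => \prod_(i <- r | P i) (f i s : R[i])) : C -> C) x 1.
Proof.
move=> df; elim: r => [|i r IH].
  by apply: eq_derivable (derivable_cst (1 : C) x 1) => s; rewrite big_nil.
case: (boolP (P i)) => Pi; last by apply: eq_derivable IH => s; rewrite big_cons (negbTE Pi).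
by apply: eq_derivable (derivableM (df i) IH) => s; rewrite big_cons Pi.
Qed.

Lemma derivable_det n (A : C -> 'M[R[i]]_n) x :
  (forall i j, derivable ((fun s => A s i j) : C -> C) x 1) ->
  derivable ((fun s => \det (A s)) : C -> C) x 1.
Proof.
move=> dA; apply: derivable_bigsum => s.
apply: derivableM; first exact: derivable_cst.
by apply: derivable_bigprod => i.
Qed.

(** Cramer's rule. Invertibility is required near [x], since [invmx] returns its argument on
    singular matrices. *)
Lemma derivable_invmx n (A : C -> 'M[R[i]]_n) x i j :
  (forall i j, derivable ((fun s => A s i j) : C -> C) x 1) ->
  (\forall s \near x, A s \in unitmx) ->
  derivable ((fun s => invmx (A s) i j) : C -> C) x 1.
Proof.
move=> dA uA.
apply: (@near_eq_derivable _ _ _ ((fun s => (\det (A s))^-1 * (\adj (A s)) i j) : C -> C)).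
  near=> s; rewrite /invmx; have -> : A s \in unitmx by near: s.
  by rewrite [RHS]mxE.
have dadj : derivable ((fun s => (\adj (A s)) i j) : C -> C) x 1.
  apply: (eq_derivable (f := (fun s => cofactor (A s) j i) : C -> C)).
    by move=> s; rewrite mxE.
  apply: derivableM; first exact: derivable_cst.
  apply: derivable_det => k l.
  by apply: eq_derivable (dA (lift j k) (lift i l)) => s; rewrite !mxE.
apply: derivableM dadj; apply: derivableV; last exact: derivable_det.
by have := nbhs_singleton uA; rewrite unitmxE unitfE.
Unshelve. all: by end_near. Qed.

End ScalarCalculus.

Section TimeCalculus.
Variables (R : realType) (D : nat).
Implicit Types (t : times R D) (al : midx D).

Lemma tshift0 t al : tshift t al 0 = t.
Proof. by apply/funext => be; rewrite /tshift; case: ifP => _; rewrite addr0. Qed.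

(** Derivability is bundled with the value, as [tderive] alone is meaningful only for derivable
    functions. *)
Definition is_tderive m n al (F : times R D -> 'M[R[i]]_(m, n)) t dF :=
  tderivable al F t /\ tderive al F t = dF.

Lemma is_tderiveP m n al (F : times R D -> 'M[R[i]]_(m, n)) t (dF : 'M[R[i]]_(m, n)) :
  (forall i j, is_derive (0 : R[i]^o) (1 : R[i]^o)
    (fun s : R[i]^o => F (tshift t al s) i j : R[i]^o) (dF i j)) <->
  is_tderive al F t dF.
Proof.
split=> [h|[dF1 <-] i j].
  split=> [i j|]; first by case: (h i j).
  by apply/matrixP => i j; rewrite mxE; case: (h i j).
by rewrite mxE; apply: derivableP; exact: dF1.
Qed.

Lemma tderivableP m n al (F : times R D -> 'M[R[i]]_(m, n)) t :
  tderivable al F t -> is_tderive al F t (tderive al F t).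
Proof. by []. Qed.

Lemma near_is_tderive m n al (F G : times R D -> 'M[R[i]]_(m, n)) t dF :
  (\forall s \near (0 : R[i]^o), F (tshift t al s) = G (tshift t al s)) ->
  is_tderive al F t dF -> is_tderive al G t dF.
Proof.
move=> FG /is_tderiveP dFF; apply/is_tderiveP => i j.
apply: near_eq_is_derive (dFF i j).
by apply: filterS FG => s ->.
Qed.

Lemma eq_is_tderive m n al (F G : times R D -> 'M[R[i]]_(m, n)) t dF :
  F =1 G -> is_tderive al F t dF -> is_tderive al G t dF.
Proof. by move=> /funext ->. Qed.

Lemma is_tderive_cst m n al (A : 'M[R[i]]_(m, n)) t :
  is_tderive al (fun _ => A) t 0.
Proof. by apply/is_tderiveP => i j; rewrite mxE; exact: is_derive_cst. Qed.

Lemma is_tderiveD m n al (F G : times R D -> 'M[R[i]]_(m, n)) t dF dG :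
  is_tderive al F t dF -> is_tderive al G t dG ->
  is_tderive al (fun u => F u + G u) t (dF + dG).
Proof.
move=> /is_tderiveP dFF /is_tderiveP dGG; apply/is_tderiveP => i j.
by rewrite mxE; apply: eq_is_derive (is_deriveD (dFF i j) (dGG i j)) => s; rewrite mxE.
Qed.

Lemma is_tderiveN m n al (F : times R D -> 'M[R[i]]_(m, n)) t dF :
  is_tderive al F t dF -> is_tderive al (fun u => - F u) t (- dF).
Proof.
move=> /is_tderiveP dFF; apply/is_tderiveP => i j.
by rewrite mxE; apply: eq_is_derive (is_deriveN (dFF i j)) => s; rewrite mxE.
Qed.

Lemma is_tderiveB m n al (F G : times R D -> 'M[R[i]]_(m, n)) t dF dG :
  is_tderive al F t dF -> is_tderive al G t dG ->
  is_tderive al (fun u => F u - G u) t (dF - dG).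
Proof. by move=> dFF dGG; apply: is_tderiveD => //; exact: is_tderiveN. Qed.

Lemma is_tderive_sum m n al p (F : 'I_p -> times R D -> 'M[R[i]]_(m, n)) t dF :
  (forall i, is_tderive al (F i) t (dF i)) ->
  is_tderive al (fun u => \sum_(i < p) F i u) t (\sum_(i < p) dF i).
Proof.
elim: p F dF => [|p IH] F dF dFF.
  rewrite big_ord0; apply: eq_is_tderive (is_tderive_cst al 0 t) => u.
  by rewrite big_ord0.
rewrite big_ord_recl; apply: eq_is_tderive (is_tderiveD (dFF ord0) (IH _ _ _)) => [u|i].
  by rewrite big_ord_recl.
exact: dFF.
Qed.

Lemma is_tderiveM m n p al (F : times R D -> 'M[R[i]]_(m, n))
    (G : times R D -> 'M[R[i]]_(n, p)) t dF dG :
  is_tderive al F t dF -> is_tderive al G t dG ->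
  is_tderive al (fun u => F u *m G u) t (dF *m G t + F t *m dG).
Proof.
move=> /is_tderiveP dFF /is_tderiveP dGG; apply/is_tderiveP => i j.
rewrite !mxE -big_split /=.
apply: (eq_is_derive (f := \sum_k ((fun s : R[i]^o => F (tshift t al s) i k : R[i]^o)
              * (fun s => G (tshift t al s) k j)))).
  by move=> s; rewrite mxE fct_sumE.
apply: is_derive_sum => k.
apply: is_derive_eq (is_deriveM (dFF i k) (dGG k j)) _.
rewrite tshift0 addrC; congr (_ + _); exact: mulrC.
Qed.

(** Cramer's rule gives derivability; the value then follows by differentiating [F^{-1} F = 1]. *)
Lemma is_tderiveV n al (F : times R D -> 'M[R[i]]_n) t dF :
  (\forall s \near (0 : R[i]^o), F (tshift t al s) \in unitmx) ->
  is_tderive al F t dF ->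
  is_tderive al (fun u => invmx (F u)) t (- (invmx (F t) *m dF *m invmx (F t))).
Proof.
move=> uF dFF.
have dV : tderivable al (fun u => invmx (F u)) t.
  by move=> i j; apply: derivable_invmx => //; case: dFF.
split=> //; have uFt : F t \in unitmx by rewrite -(tshift0 t al); exact: nbhs_singleton uF.
have := is_tderiveM (tderivableP dV) dFF.
have d0 : is_tderive al (fun u => invmx (F u) *m F u) t 0.
  apply: near_is_tderive (is_tderive_cst al 1%:M t).
  by apply: filterS uF => s Fs; rewrite mulVmx.
move=> [_]; have [_ ->] := d0 => /eqP; rewrite eq_sym addr_eq0 => /eqP VF.
by rewrite -[LHS](mulmxK uFt) VF mulNmx.
Qed.

End TimeCalculus.

(** * The complex exponential *)

Section ComplexExponential.
Variable R : realType.
Implicit Types (w x y : R[i]).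

(** The l1 norm is real valued, unlike the modulus on [R[i]], submultiplicative, and suited to
    integrals defined by components. *)
Definition cnorm1 w : R := `|complex.Re w| + `|complex.Im w|.

Lemma cnorm1_ge0 w : 0 <= cnorm1 w. Proof. exact: addr_ge0. Qed.

Lemma ReM x y :
  complex.Re (x * y) = complex.Re x * complex.Re y - complex.Im x * complex.Im y.
Proof. by case: x; case: y. Qed.

Lemma ImM x y :
  complex.Im (x * y) = complex.Re x * complex.Im y + complex.Im x * complex.Re y.
Proof. by case: x; case: y. Qed.

Lemma cnorm1D x y : cnorm1 (x + y) <= cnorm1 x + cnorm1 y.
Proof.
case: x y => [a b] [c d]; rewrite /cnorm1 /=.
have := ler_normD a c; have := ler_normD b d; lra.
Qed.

Lemma cnorm1N x : cnorm1 (- x) = cnorm1 x.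
Proof. by case: x => a b; rewrite /cnorm1 /= !normrN. Qed.

Lemma cnorm1M x y : cnorm1 (x * y) <= cnorm1 x * cnorm1 y.
Proof.
rewrite /cnorm1 ReM ImM mulrDl !mulrDr -!normrM.
have := ler_normB (complex.Re x * complex.Re y) (complex.Im x * complex.Im y).
have := ler_normD (complex.Re x * complex.Im y) (complex.Im x * complex.Re y).
lra.
Qed.

Lemma Re_le_norm x : (`|complex.Re x|)%:C%C <= `|x|.
Proof. exact: normc_ge_Re. Qed.

Lemma Im_le_norm x : (`|complex.Im x|)%:C%C <= `|x|.
Proof.
by case: x => a b; rewrite lecE /= eqxx /= -sqrtr_sqr ler_wsqrtr // lerDr sqr_ge0.
Qed.

Lemma normc_real x : `|x| = (complex.Re `|x|)%:C%C.
Proof. by case: x. Qed.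

Lemma cnorm1_le_norm x : cnorm1 x <= 2 * complex.Re `|x|.
Proof.
have := Re_le_norm x; have := Im_le_norm x; rewrite normc_real !lecR /cnorm1; lra.
Qed.

Lemma norm_le_cnorm1 x : `|x| <= (cnorm1 x)%:C%C.
Proof.
case: x => a b; rewrite lecE /= eqxx /= /cnorm1 /=.
rewrite -(ler_pXn2r (n := 2)) ?nnegrE ?sqrtr_ge0 ?addr_ge0 //.
rewrite sqr_sqrtr ?addr_ge0 ?sqr_ge0 // sqrrD !real_normK ?num_real //.
by rewrite -addrA lerD2l lerDr mulrn_wge0 // mulr_ge0.
Qed.

Lemma cexpD x y : cexp (x + y) = cexp x * cexp y.
Proof.
case: x y => [a b] [c d]; apply/eqP; rewrite eq_complex /= expRD cosD sinD.
by apply/andP; split; apply/eqP; ring.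
Qed.

Lemma cexp0 : cexp (0 : R[i]) = 1.
Proof. by rewrite /cexp /= expR0 cos0 sin0 mulr0 mulr1. Qed.

(** From [1 + x <= expR x] and [expR x * (1 - x) <= 1]. After multiplication by [1 - x] the upper
    bound reduces to [0 <= x ^+ 2 * (1 - 2 * x)], whence the radius one half. *)
Lemma expR_taylor1 (x : R) : `|x| <= 2^-1 -> `|expR x - 1 - x| <= 2 * x ^+ 2.
Proof.
move=> /ler_normlP [x1 x2].
have e1 := expR_ge1Dx x; have e2 := expR_ge1Dx (- x).
have e3 : expR x * expR (- x) = 1 by rewrite -expRD subrr expR0.
have e4 : expR x * (1 - x) <= 1 by have := ler_wpM2l (expR_ge0 x) e2; rewrite e3.
rewrite ger0_norm; last by lra.
have : (expR x - 1 - x - 2 * x ^+ 2) * (1 - x) <= 0.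
  have : expR x * (1 - x) <= 1 by [].
  have : 0 <= x ^+ 2 * (1 - 2 * x) by rewrite mulr_ge0 ?sqr_ge0 //; lra.
  rewrite !expr2; nra.
rewrite pmulr_lle0; lra.
Qed.

Lemma norm_sin_le (y : R) : `|sin y| <= `|y|.
Proof.
wlog y0 : y / 0 <= y.
  move=> h; case: (leP 0 y) => [|y0]; first exact: h.
  by rewrite -normrN -(normrN y) -sinN h // oppr_ge0 ltW.
have [c _] := MVT_segment y0 (fun u _ => is_derive_sin u)
  (continuous_subspaceT (@continuous_sin R)).
rewrite sin0 !subr0 => ->; rewrite normrM ler_piMl // cos_max //.
Qed.

Lemma norm_cosB1_le (y : R) : `|cos y - 1| <= y ^+ 2.
Proof.
have -> : cos y - 1 = - (2 * sin (y / 2) ^+ 2).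
  by have := cosD (y / 2) (y / 2); have := cos2Dsin2 (y / 2); rewrite -splitr; lra.
rewrite normrN normrM normrX (ger0_norm (x := 2)) // -(real_normK (num_real y)).
have := norm_sin_le (y / 2); rewrite [`|y / 2|]normrM (ger0_norm (x := 2^-1)) //.
have := normr_ge0 (sin (y / 2)); have := normr_ge0 y; rewrite !expr2; nra.
Qed.

Lemma norm_sinB_le (y : R) : `|y| <= 1 -> `|sin y - y| <= y ^+ 2.
Proof.
wlog y0 : y / 0 <= y.
  move=> h; case: (leP 0 y) => [|y0 y1]; first exact: h.
  rewrite -normrN opprD opprK -{1}(opprK y) sinN opprK -sqrrN.
  by rewrite -(opprK y) sinN !opprK; move: (h (- y)); rewrite sinN opprK sqrrN normrN => ->;
    rewrite // oppr_ge0 ltW.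
move=> y1; have [c] := MVT_segment y0 (fun u _ => is_derive_sin u)
  (continuous_subspaceT (@continuous_sin R)).
rewrite in_itv /= sin0 !subr0 => /andP[c0 cy] ->.
have -> : cos c * y - y = (cos c - 1) * y by ring.
rewrite normrM (ger0_norm y0) expr2 ler_wpM2r //.
apply: le_trans (norm_cosB1_le c) _; move: y1; rewrite ger0_norm // expr2; nra.
Qed.

Lemma cexp_taylor1 w : cnorm1 w <= 2^-1 -> cnorm1 (cexp w - 1 - w) <= 8 * cnorm1 w ^+ 2.
Proof.
case: w => x y; rewrite /cnorm1 /= => xy.
have [x0 y0] := (normr_ge0 x, normr_ge0 y).
have hx : `|x| <= 2^-1 by lra.
have hy : `|y| <= 2^-1 by lra.
have ex := expR_taylor1 hx.
have cy := norm_cosB1_le y; have sy := norm_sin_le y.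
have sy2 : `|sin y - y| <= y ^+ 2 by apply: norm_sinB_le; lra.
have x2 : x ^+ 2 = `|x| ^+ 2 by rewrite real_normK ?num_real.
have y2 : y ^+ 2 = `|y| ^+ 2 by rewrite real_normK ?num_real.
have ex1 : `|expR x - 1| <= 2 * `|x|.
  have := ler_normD (expR x - 1 - x) x; rewrite subrK; move: ex; rewrite x2 expr2; nra.
have ex2 : `|expR x| <= 2.
  have := ler_normD (expR x - 1) 1; rewrite subrK normr1; lra.
rewrite oppr0 addr0.
(* Each component splits into terms bounded by the real estimates; the constant 8 is a crude
   majorant of their sum. *)
have -> : expR x * cos y - 1 - x = (expR x - 1 - x) + expR x * (cos y - 1) by ring.
have -> : expR x * sin y - y = (expR x - 1) * sin y + (sin y - y) by ring.
have h1 := ler_normD (expR x - 1 - x) (expR x * (cos y - 1)).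
have h2 := ler_normD ((expR x - 1) * sin y) (sin y - y).
have h3 : `|expR x * (cos y - 1)| <= 2 * `|y| ^+ 2.
  by rewrite normrM -y2 ler_pM.
have h4 : `|(expR x - 1) * sin y| <= 2 * `|x| * `|y| by rewrite normrM ler_pM.
move: h1 h2 h3 h4 ex sy2; rewrite x2 y2 !expr2; nra.
Qed.

Lemma is_derive_quadratic (f : R[i]^o -> R[i]^o) (d : R[i]^o) (K r : R) : 0 < r ->
  (forall s : R[i]^o, cnorm1 s <= r -> cnorm1 (f s - f 0 - s * d) <= K * cnorm1 s ^+ 2) ->
  is_derive (0 : R[i]^o) 1 f d.
Proof.
move=> r0 fK.
suff cf : (fun h : R[i]^o => (h : R[i])^-1 *: ((f \o shift 0) ((h : R[i]) *: 1) - f 0))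
    @ (0 : R[i]^o)^' --> d.
  by apply: DeriveDef; [exact: cvgP cf | exact: cvg_lim cf].
apply/cvgrPdist_le => /= eps eps0.
have [e e0 ->] : exists2 e : R, 0 < e & eps = e%:C%C.
  by case: eps eps0 => a b; rewrite ltcE /= => /andP[/eqP -> a0]; exists a.
(* The 4 is the square of the 2 in [cnorm1_le_norm]; adding 1 keeps [M] positive when [K = 0]. *)
pose M := 4 * `|K| + 1; have M0 : 0 < M by rewrite ltr_wpDl // mulr_ge0.
near=> h.
have hn0 : h != 0 by near: h; exact: nbhs_dnbhs_neq.
have : `|h| < (Num.min (r / 2) (e / M))%:C%C.
  near: h; apply: nbhs_dnbhs; apply/nbhs_ballP.
  exists (Num.min (r / 2) (e / M))%:C%C => /=.
    by rewrite ltcR lt_min !divr_gt0.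
  by move=> y; rewrite -ball_normE /= sub0r normrN.
rewrite normc_real ltcR lt_min => /andP[hr he].
have h1 := cnorm1_le_norm h; set n := complex.Re `|h| in hr he h1.
have fh : cnorm1 (f h - f 0 - h * d) <= K * cnorm1 h ^+ 2.
  by apply: fK; move: hr; rewrite ltr_pdivlMr //; lra.
rewrite addr0 /GRing.scale /= mulr1.
have -> : d - h^-1 * (f h - f 0) = - (h^-1 * (f h - f 0 - h * d)).
  have aux (x y z : R[i]) : x != 0 -> z - x^-1 * y = - (x^-1 * (y - x * z)).
    by move=> x0; field.
  exact: aux.
rewrite normrN normrM normfV ler_pdivrMl ?normr_gt0 //.
apply: le_trans (norm_le_cnorm1 _) _; rewrite (normc_real h) -/n -rmorphM /= lecR.
apply: le_trans fh _.
have c0 := cnorm1_ge0 h.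
have n0 : 0 <= n by lra.
have : cnorm1 h ^+ 2 <= 4 * n ^+ 2 by rewrite !expr2; nra.
have : K <= `|K| by exact: ler_norm.
move: he; rewrite ltr_pdivlMr // /M => he KK c2.
have := normr_ge0 K; have := sqr_ge0 (cnorm1 h); rewrite !expr2 in c2 *; nra.
Unshelve. all: by end_near. Qed.

End ComplexExponential.

(** * Integration against a complex measure *)

Section ComplexIntegral.
Context d (T : measurableType d) (R : realType).
Implicit Types (f g h : T -> R[i]) (p : {measure set T -> \bar R}).

Definition cmeasurable f : Prop :=
  measurable_fun setT (fun x => complex.Re (f x)) /\
  measurable_fun setT (fun x => complex.Im (f x)).

Definition cbounded f : Prop := exists K, forall x, cnorm1 (f x) <= K.

Definition pintegrable p f : Prop :=
  p.-integrable setT (EFin \o (fun x => complex.Re (f x))) /\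
  p.-integrable setT (EFin \o (fun x => complex.Im (f x))).

Definition pintegral p f : R[i] :=
  ((\int[p]_(x in setT) complex.Re (f x)) +i* (\int[p]_(x in setT) complex.Im (f x)))%C.

Lemma cmeasurableM f g : cmeasurable f -> cmeasurable g ->
  cmeasurable (fun x => f x * g x).
Proof.
move=> [f1 f2] [g1 g2]; split.
  under eq_fun do rewrite ReM.
  by apply: measurable_funB; exact: measurable_funM.
under eq_fun do rewrite ImM.
by apply: measurable_funD; exact: measurable_funM.
Qed.

Lemma cmeasurableB f g : cmeasurable f -> cmeasurable g ->
  cmeasurable (fun x => f x - g x).
Proof.
move=> [f1 f2] [g1 g2]; split.
  under eq_fun do rewrite raddfB /=; exact: measurable_funB.
under eq_fun do rewrite raddfB /=; exact: measurable_funB.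
Qed.

Lemma cmeasurable_cst (c : R[i]) : cmeasurable (fun=> c).
Proof. by split; exact: measurable_cst. Qed.

Lemma cmeasurable_cexp f : cmeasurable f -> cmeasurable (fun x => cexp (f x)).
Proof.
move=> [f1 f2].
have e1 : measurable_fun setT (fun x => expR (complex.Re (f x))).
  by apply: measurableT_comp f1; exact: measurable_expR.
have trig (h : R -> R) : continuous h -> measurable_fun setT (fun x => h (complex.Im (f x))).
  by move=> ch; apply: measurableT_comp f2; exact: continuous_measurable_fun.
split.
  rewrite (_ : (fun x => _) = (fun x => expR (complex.Re (f x)) * cos (complex.Im (f x)))).
    by apply: measurable_funM => //; apply: trig; exact: continuous_cos.
  by apply/funext => x; case: (f x).
rewrite (_ : (fun x => _) = (fun x => expR (complex.Re (f x)) * sin (complex.Im (f x)))).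
  by apply: measurable_funM => //; apply: trig; exact: continuous_sin.
by apply/funext => x; case: (f x).
Qed.

Lemma pintegrableM p f g : pintegrable p f -> cmeasurable g -> cbounded g ->
  pintegrable p (fun x => f x * g x).
Proof.
move=> [f1 f2] [g1 g2] [K gK].
have bnd (u : T -> R) : (forall x, `|u x| <= cnorm1 (g x)) -> [bounded u x | x in setT].
  move=> ug; exists K; split; first exact: num_real.
  by move=> M KM x _ /=; apply: le_trans (ug x) (le_trans (gK x) (ltW KM)).
have b1 : [bounded complex.Re (g x) | x in setT] by apply: bnd => x; rewrite lerDl.
have b2 : [bounded complex.Im (g x) | x in setT] by apply: bnd => x; rewrite lerDr.
have mT := @measurableT _ T.
split.
  have := integrableB mT (integrableMl mT f1 g1 b1) (integrableMl mT f2 g2 b2).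
  by apply: eq_integrable => // x _ /=; rewrite ReM.
have := integrableD mT (integrableMl mT f1 g2 b2) (integrableMl mT f2 g1 b1).
by apply: eq_integrable => // x _ /=; rewrite ImM.
Qed.

Lemma pintegralB p f g : pintegrable p f -> pintegrable p g ->
  pintegral p (fun x => f x - g x) = pintegral p f - pintegral p g.
Proof.
move=> [f1 f2] [g1 g2]; rewrite /pintegral.
have mT := @measurableT _ T.
have -> : \int[p]_(x in setT) complex.Re (f x - g x) =
  \int[p]_(x in setT) complex.Re (f x) - \int[p]_(x in setT) complex.Re (g x).
  by rewrite -RintegralB //; apply: eq_Rintegral => x _; rewrite raddfB.
have -> : \int[p]_(x in setT) complex.Im (f x - g x) =
  \int[p]_(x in setT) complex.Im (f x) - \int[p]_(x in setT) complex.Im (g x).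
  by rewrite -RintegralB //; apply: eq_Rintegral => x _; rewrite raddfB.
by [].
Qed.

Lemma pintegralZl p f (c : R[i]) : pintegrable p f ->
  pintegral p (fun x => c * f x) = c * pintegral p f.
Proof.
move=> [f1 f2]; have mT := @measurableT _ T.
have Z (r : R) (u : T -> R) : p.-integrable setT (EFin \o u) ->
    p.-integrable setT (EFin \o (fun x => r * u x)).
  by move=> pu; have := integrableZl mT r pu; exact: eq_integrable.
case: c => a b; rewrite /pintegral.
have -> : \int[p]_(x in setT) complex.Re ((a +i* b)%C * f x) =
  a * \int[p]_(x in setT) complex.Re (f x) - b * \int[p]_(x in setT) complex.Im (f x).
  rewrite -!RintegralZl // -RintegralB //; try exact: Z.
  by apply: eq_Rintegral => x _; rewrite ReM.
have -> : \int[p]_(x in setT) complex.Im ((a +i* b)%C * f x) =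
  a * \int[p]_(x in setT) complex.Im (f x) + b * \int[p]_(x in setT) complex.Re (f x).
  rewrite -!RintegralZl // -RintegralD //; try exact: Z.
  by apply: eq_Rintegral => x _; rewrite ImM.
by [].
Qed.

Lemma cnorm1_pintegral p f : pintegrable p f ->
  cnorm1 (pintegral p f) <= \int[p]_(x in setT) cnorm1 (f x).
Proof.
move=> [f1 f2]; have mT := @measurableT _ T.
rewrite /cnorm1 RintegralD //; try exact: integrable_norm.
by apply: lerD; exact: le_normr_Rintegral.
Qed.

(** Since [c] is bounded, [cexp_taylor1] holds uniformly in [x]. The remainder is the integral of
    [h] times a function of size [8 K^2 cnorm1 s ^+ 2], so no convergence theorem is involved. *)
Lemma pintegral_cexp_taylor1 p h c (K : R) : pintegrable p h -> cmeasurable c ->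
    (forall x, cnorm1 (c x) <= K) ->
  exists M, forall s : R[i], cnorm1 s * K <= 2^-1 ->
    cnorm1 (pintegral p (fun x => h x * cexp (s * c x)) - pintegral p h
            - s * pintegral p (fun x => h x * c x)) <= M * cnorm1 s ^+ 2.
Proof.
move=> hi mc cK; have mT := @measurableT _ T.
have hn : p.-integrable setT (EFin \o (fun x => cnorm1 (h x))).
  case: hi => h1 h2; have := integrableD mT (integrable_norm h1) (integrable_norm h2).
  by apply: eq_integrable.
exists (8 * K ^+ 2 * \int[p]_(x in setT) cnorm1 (h x)) => s sK.
have scK x : cnorm1 (s * c x) <= cnorm1 s * K.
  by apply: le_trans (cnorm1M _ _) _; rewrite ler_wpM2l ?cnorm1_ge0.
have msc : cmeasurable (fun x => s * c x) by apply: cmeasurableM => //; exact: cmeasurable_cst.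
pose e x := cexp (s * c x) - 1 - s * c x.
have me : cmeasurable e.
  exact: cmeasurableB (cmeasurableB (cmeasurable_cexp msc) (cmeasurable_cst 1)) msc.
have eK x : cnorm1 (e x) <= 8 * K ^+ 2 * cnorm1 s ^+ 2.
  apply: le_trans (cexp_taylor1 (le_trans (scK x) sK)) _.
  rewrite -mulrA ler_wpM2l // -exprMn ler_pXn2r ?nnegrE ?cnorm1_ge0 //.
    by rewrite [K * _]mulrC; exact: scK.
  by rewrite [K * _]mulrC; exact: le_trans (cnorm1_ge0 _) (scK x).
have hei : pintegrable p (fun x => h x * e x).
  by apply: pintegrableM => //; exists (8 * K ^+ 2 * cnorm1 s ^+ 2).
have hci : pintegrable p (fun x => h x * c x) by apply: pintegrableM => //; exists K.
have hsci : pintegrable p (fun x => s * (h x * c x)).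
  have : pintegrable p (fun x => h x * (s * c x)).
    by apply: pintegrableM => //; exists (cnorm1 s * K).
  by under eq_fun do rewrite mulrCA.
have hexpi : pintegrable p (fun x => h x * cexp (s * c x)).
  apply: pintegrableM => //; first exact: cmeasurable_cexp.
  exists (8 * K ^+ 2 * cnorm1 s ^+ 2 + cnorm1 (1 : R[i]) + cnorm1 s * K) => x.
  have -> : cexp (s * c x) = e x + 1 + s * c x by rewrite /e; ring.
  by do 2!(apply: le_trans (cnorm1D _ _) _; apply: lerD => //).
rewrite -pintegralZl // -!pintegralB //; last first.
  case: hexpi hi => a1 a2 [b1 b2]; split.
    have := integrableB mT a1 b1; apply: eq_integrable => // x _ /=; by rewrite raddfB.
  have := integrableB mT a2 b2; apply: eq_integrable => // x _ /=; by rewrite raddfB.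
have -> : (fun x => h x * cexp (s * c x) - h x - s * (h x * c x)) = (fun x => h x * e x).
  by apply/funext => x; rewrite /e; ring.
apply: le_trans (cnorm1_pintegral hei) _.
rewrite mulrAC -RintegralZl //; apply: le_Rintegral => //.
- case: hei => a1 a2; have := integrableD mT (integrable_norm a1) (integrable_norm a2).
  by apply: eq_integrable.
- by have := integrableZl mT (8 * K ^+ 2 * cnorm1 s ^+ 2) hn; apply: eq_integrable.
move=> x _; apply: le_trans (cnorm1M _ _) _.
by rewrite mulrC ler_wpM2r ?cnorm1_ge0.
Qed.

Variable mu : {charge set T -> \bar R[i]}.

Lemma cintegralE f : cintegral mu f =
  pintegral (pos_var (re_part mu)) f - pintegral (neg_var (re_part mu)) f
  + 'i%C * (pintegral (pos_var (im_part mu)) f - pintegral (neg_var (im_part mu)) f).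
Proof.
apply/eqP; rewrite eq_complex /cintegral /Defs.sintegral /pintegral /=; apply/andP.
by split; apply/eqP; ring.
Qed.

Lemma cintegrableP f : cintegrable mu f <->
  [/\ pintegrable (pos_var (re_part mu)) f, pintegrable (neg_var (re_part mu)) f,
      pintegrable (pos_var (im_part mu)) f & pintegrable (neg_var (im_part mu)) f].
Proof.
by split=> [[[? ?] [? ?] [? ?] [? ?]]|[[? ?] [? ?] [? ?] [? ?]]]; split; split.
Qed.

Lemma cintegrableM f g : cintegrable mu f -> cmeasurable g -> cbounded g ->
  cintegrable mu (fun x => f x * g x).
Proof.
move=> /cintegrableP[? ? ? ?] mg bg; apply/cintegrableP.
by split; exact: pintegrableM.
Qed.

Lemma is_derive_cintegral_cexp h c : cintegrable mu h -> cmeasurable c -> cbounded c ->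
  is_derive (0 : R[i]^o) (1 : R[i]^o)
    (fun s : R[i]^o => cintegral mu (fun x => h x * cexp (s * c x)) : R[i]^o)
    (cintegral mu (fun x => h x * c x)).
Proof.
move=> /cintegrableP[i1 i2 i3 i4] mc [K0 cK0].
(* The bound is made positive so that [2^-1 / K] is a radius. *)
pose K := `|K0| + 1; have K_gt0 : 0 < K by rewrite ltr_wpDl.
have cK x : cnorm1 (c x) <= K.
  by apply: le_trans (cK0 x) (le_trans (ler_norm _) _); rewrite lerDl.
have [M1 h1] := pintegral_cexp_taylor1 i1 mc cK.
have [M2 h2] := pintegral_cexp_taylor1 i2 mc cK.
have [M3 h3] := pintegral_cexp_taylor1 i3 mc cK.
have [M4 h4] := pintegral_cexp_taylor1 i4 mc cK.
apply: (@is_derive_quadratic _ _ _ (M1 + M2 + M3 + M4) (2^-1 / K)).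
  by rewrite divr_gt0.
move=> s; rewrite ler_pdivlMr // => sK.
have -> : (fun x => h x * cexp (0 * c x)) = h.
  by apply/funext => x; rewrite mul0r cexp0 mulr1.
rewrite !cintegralE.
move: (h1 s sK) (h2 s sK) (h3 s sK) (h4 s sK).
set a1 := pintegral _ (fun x => h x * cexp _); set b1 := pintegral _ h.
set c1 := pintegral _ (fun x => h x * c x); set d1 := a1 - b1 - s * c1.
set a2 := pintegral _ (fun x => h x * cexp _); set b2 := pintegral _ h.
set c2 := pintegral _ (fun x => h x * c x); set d2 := a2 - b2 - s * c2.
set a3 := pintegral _ (fun x => h x * cexp _); set b3 := pintegral _ h.
set c3 := pintegral _ (fun x => h x * c x); set d3 := a3 - b3 - s * c3.
set a4 := pintegral _ (fun x => h x * cexp _); set b4 := pintegral _ h.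
set c4 := pintegral _ (fun x => h x * c x); set d4 := a4 - b4 - s * c4.
move=> k1 k2 k3 k4.
have -> : a1 - a2 + 'i%C * (a3 - a4) - (b1 - b2 + 'i%C * (b3 - b4))
    - (s : R[i]) * (c1 - c2 + 'i%C * (c3 - c4)) = (d1 - d2) + 'i%C * (d3 - d4).
  by rewrite /d1 /d2 /d3 /d4; ring.
have ci : cnorm1 ('i%C : R[i]) = 1 by rewrite /cnorm1 /= normr0 normr1 add0r.
have l1 := cnorm1D (d1 - d2) ('i%C * (d3 - d4)).
have l2 := cnorm1D d1 (- d2); have l3 := cnorm1D d3 (- d4).
have l4 := cnorm1M 'i%C (d3 - d4).
rewrite !cnorm1N in l2 l3; rewrite ci mul1r in l4.
lra.
Qed.

End ComplexIntegral.

(** * Moments on the torus *)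

Section Torus.
Variables (R : realType) (D : nat).
Implicit Types (z : torus R D) (al be : midx D) (t : times R D).

Lemma continuous_Re : continuous (fun w : R[i]^o => complex.Re w : R).
Proof.
move=> w; apply/(@cvgrPdist_le _ _ _ _ (nbhs_filter w)) => e e0.
apply/nbhs_ballP; exists e%:C%C => /=.
  by rewrite ltcR.
move=> y; rewrite -ball_normE /= => /ltW wy.
by rewrite -raddfB -lecR; apply: le_trans wy; exact: Re_le_norm.
Qed.

Lemma continuous_Im : continuous (fun w : R[i]^o => complex.Im w : R).
Proof.
move=> w; apply/(@cvgrPdist_le _ _ _ _ (nbhs_filter w)) => e e0.
apply/nbhs_ballP; exists e%:C%C => /=.
  by rewrite ltcR.
move=> y; rewrite -ball_normE /= => /ltW wy.
by rewrite -raddfB -lecR; apply: le_trans wy; exact: Im_le_norm.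
Qed.

Lemma continuous_coord (a : 'I_D) :
  continuous (fun z => (set_val z : 'rV[R[i]^o]_D) 0 a).
Proof.
move=> z; apply: (@continuous_comp _ _ _ set_val (fun x : 'rV[R[i]^o]_D => x 0 a)).
  exact: initial_continuous.
exact: coord_continuous.
Qed.

Lemma continuous_measurable_torus (f : torus R D -> R) :
  continuous f -> measurable_fun setT (f : btorus R D -> R).
Proof.
move=> cf; apply: (measurability _ (RGenOpens.measurableE R)) => _ [B [x [y ->]] <-].
rewrite setTI; apply: sub_sigma_algebra.
by apply: open_comp => // z _; exact: cf.
Qed.

Lemma cmeasurable_coord (a : 'I_D) :
  cmeasurable (fun z : btorus R D => (set_val z : 'rV[R[i]^o]_D) 0 a : R[i]).
Proof.
split; apply: continuous_measurable_torus => z.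
  by apply: (@continuous_comp _ _ _ _ (fun w : R[i]^o => complex.Re w : R));
    [exact: continuous_coord | exact: continuous_Re].
by apply: (@continuous_comp _ _ _ _ (fun w : R[i]^o => complex.Im w : R));
  [exact: continuous_coord | exact: continuous_Im].
Qed.

Lemma cmeasurable_conj d (T : measurableType d) (f : T -> R[i]) :
  cmeasurable f -> cmeasurable (fun x => (f x)^*).
Proof.
move=> [f1 f2]; split.
  by rewrite (_ : (fun x => _) = (fun x => complex.Re (f x))) //;
    apply/funext => x; case: (f x).
rewrite (_ : (fun x => _) = (\- (fun x => complex.Im (f x)))); first exact: measurable_funN.
by apply/funext => x /=; case: (f x).
Qed.

Lemma norm_coord z (a : 'I_D) : `|((set_val z : 'rV[R[i]^o]_D) 0 a : R[i])| = 1.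
Proof. by have /set_mem := svalP z; exact. Qed.

Lemma norm_monomial al z : `|monomial al z| = 1.
Proof.
rewrite /monomial normr_prod big1 // => a _.
case: (al 0 a) => n; first by rewrite -exprnP normrX norm_coord expr1n.
by rewrite NegzE -exprnN normfV normrX norm_coord expr1n invr1.
Qed.

Lemma monomialD al be z : monomial (al + be) z = monomial al z * monomial be z.
Proof.
rewrite /monomial -big_split /=; apply: eq_bigr => a _.
by rewrite mxE expfzDr // -normr_gt0 norm_coord.
Qed.

Lemma monomial0 z : monomial 0 z = 1.
Proof. by rewrite /monomial big1 // => a _; rewrite mxE expr0z. Qed.

(** On the torus the inverse of a monomial is its conjugate. *)
Lemma monomialN al z : monomial (- al) z = (monomial al z)^*.
Proof.
have nz : monomial al z != 0 by rewrite -normr_gt0 norm_monomial.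
apply: (mulfI nz); rewrite -monomialD subrr monomial0.
by rewrite -normCK norm_monomial expr1n.
Qed.

Lemma cmeasurable_monomial al : cmeasurable (fun z : btorus R D => monomial al z).
Proof.
have mprod (I : Type) (r : seq I) (f : I -> btorus R D -> R[i]) :
    (forall i, cmeasurable (f i)) -> cmeasurable (fun z : btorus R D => \prod_(i <- r) f i z).
  move=> mf; elim: r => [|i r IH].
    by under eq_fun do rewrite big_nil; exact: cmeasurable_cst.
  by under eq_fun do rewrite big_cons; exact: cmeasurableM.
apply: mprod => a; case: (al 0 a) => n.
  elim: n => [|n IH]; first exact: cmeasurable_cst.
  by under eq_fun do rewrite exprSz; apply: cmeasurableM => //; exact: cmeasurable_coord.
(* Negative powers are treated as powers of the conjugate coordinate. *)
have mc := cmeasurable_conj (cmeasurable_coord a).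
have -> : (fun z : btorus R D => ((set_val z : 'rV[R[i]^o]_D) 0 a : R[i]) ^ Negz n) =
    (fun z => ((((set_val z : 'rV[R[i]^o]_D) 0 a : R[i]))^*) ^+ n.+1).
  apply/funext => z; rewrite NegzE -exprnN -exprVn; congr (_ ^+ _).
  by rewrite invC_norm norm_coord expr1n invr1 mul1r.
elim: n.+1 => [|m IH]; first exact: cmeasurable_cst.
by under eq_fun do rewrite exprS; exact: cmeasurableM.
Qed.

Lemma cbounded_monomial al : cbounded (fun z : btorus R D => monomial al z).
Proof. by exists 2 => z; have := cnorm1_le_norm (monomial al z); rewrite norm_monomial mulr1. Qed.

Lemma tpartial_tshift t al s z n : tpartial (tshift t al s) z n =
  tpartial t z n + (if (mlen al < n)%N then s * monomial al z else 0).
Proof.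
rewrite /tpartial /tshift.
under eq_bigr => k _ do (under eq_bigr do rewrite mulrDl; rewrite big_split /=).
rewrite big_split /=; congr (_ + _).
have inner k : \sum_(be <- level D k) (if be == al then s else 0) * monomial be z =
    if mlen al == k then s * monomial al z else 0.
  rewrite -mem_level; case: ifP => alk.
    rewrite (bigD1_seq al) ?level_uniq //= eqxx big1 ?addr0 // => be /negbTE ->.
    by rewrite mul0r.
  rewrite big_seq big1 // => be bek; case: eqP bek => [->|_ _]; first by rewrite alk.
  by rewrite mul0r.
under eq_bigr do rewrite inner; case: ltnP => aln.
  rewrite (bigD1 (Ordinal aln)) //= eqxx big1 ?addr0 // => k kal.
  by rewrite ifN // eq_sym; apply: contraNneq kal => kal; apply/eqP/val_inj.
by rewrite big1 // => k _; rewrite ifN //; move: (ltn_ord k); lia.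
Qed.

(** Shifting one time adds a single term to the graded partial sums, present as soon as [n] exceeds
    [mlen al]. *)
Lemma tsum_tshift t al s z : cvgn (tpartial t z) ->
  tsum (tshift t al s) z = tsum t z + s * monomial al z.
Proof.
move=> ct; rewrite {1}/tsum.
suff cs : tpartial (tshift t al s) z @ \oo --> (tsum t z + s * monomial al z : R[i]^o).
  exact: (cvg_lim (@norm_hausdorff _ R[i]^o) cs).
have -> : tpartial (tshift t al s) z = (fun n => tpartial t z n +
    ((if (mlen al < n)%N then s * monomial al z else 0) : R[i]^o)).
  by apply/funext => n; exact: tpartial_tshift.
apply: cvgD; first exact: ct.
apply: cvg_near_cst; exists (mlen al).+1 => // n /= aln.
by rewrite aln.
Qed.

End Torus.

Section Gram.
Variables (R : realType) (D : nat) (mu : {charge set (btorus R D) -> \bar R[i]}).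
Implicit Types (al be ga : midx D) (t : times R D) (a b : sindex D).

(** The Gram entry with indices ranging over all of [Z^D], so that shifted indices need not be
    located in a block. *)
Definition moment t al be : R[i] :=
  cintegral mu (fun z => monomial al z * cexp (tsum t z) * (monomial be z)^*).

(** This Toeplitz property is why left and right multiplication of the moment matrix by [Upsilon]
    agree. *)
Lemma moment_shift t al be ga : moment t (al + ga) be = moment t al (be - ga).
Proof.
congr cintegral; apply/funext => z.
by rewrite !monomialD monomialN rmorphM /= conjCK; ring.
Qed.

Lemma is_derive_moment t al be ga : deformable mu t ->
  is_derive (0 : R[i]^o) (1 : R[i]^o)
    (fun s : R[i]^o => moment (tshift t ga s) al be : R[i]^o) (moment t (al + ga) be).
Proof.
move=> [ct it].
(* The two monomials merge into one bounded factor, and a shift of [t] along [ga] multiplies the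
   integrand by [cexp (s * monomial ga z)]. *)
pose h z := cexp (tsum t z) * (monomial (al - be) z : R[i]).
have hi : cintegrable mu h.
  by apply: cintegrableM => //; [exact: cmeasurable_monomial | exact: cbounded_monomial].
have := is_derive_cintegral_cexp hi (cmeasurable_monomial R ga) (cbounded_monomial R ga).
have -> : cintegral mu (fun z => h z * monomial ga z) = moment t (al + ga) be.
  congr cintegral; apply/funext => z.
  by rewrite /h !monomialD monomialN; ring.
apply: eq_is_derive => s; congr cintegral; apply/funext => z.
by rewrite tsum_tshift // cexpD /h monomialD monomialN; ring.
Qed.

Lemma mlen_svec al a : mlen (al + svec a) = (mlen al).+1 \/ mlen al = (mlen (al + svec a)).+1.
Proof.
rewrite /mlen !(bigD1 a.1 (P := xpredT)) //=.
have -> : (\sum_(i < D | i != a.1) `|(al + svec a)%R 0%R i| =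
   \sum_(i < D | i != a.1) `|al 0%R i|)%N.
  apply: eq_bigr => i ia; rewrite mxE /svec.
  by case: ifP => _; rewrite !mxE eqxx (negbTE ia) ?oppr0 addr0.
rewrite mxE /svec; case: ifP => _; rewrite !mxE !eqxx /=;
  move: (al 0 a.1) (\sum_(i < D | _) _)%N => u v; lia.
Qed.

Lemma UpsilonE a k l i j : Upsilon R a k l i j = (lidx i + svec a == lidx j)%:R.
Proof.
rewrite /Upsilon /svec; case: ifP => _; rewrite !mxE //.
by rewrite [in RHS]subr_eq eq_sym.
Qed.

Lemma Upsilon_banded a : banded (@Upsilon R D a).
Proof.
move=> k l lk kl; apply/matrixP => i j; rewrite UpsilonE mxE.
case: eqP => // ij; have := mlen_svec (lidx i) a; rewrite ij !mlen_lidx.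
by move=> [] h; move: lk kl; rewrite h eqxx.
Qed.

(** Each multi-index occurs exactly once, in block [mlen al]; a block sum thus becomes evaluation at
    one index. *)
Lemma sum_lidx n (f : midx D -> R[i]) al : (mlen al < n)%N ->
  \sum_(k < n) \sum_(i < levelsz D k) (al == lidx i)%:R * f (lidx i) = f al.
Proof.
move=> aln.
have inner k : \sum_(i < levelsz D k) (al == lidx i)%:R * f (lidx i) =
    (mlen al == k)%:R * f al.
  rewrite -mem_level; case: (boolP (al \in level D k)) => alk; last first.
    rewrite mul0r big1 // => i _; case: eqP => [ali|_]; last by rewrite mul0r.
    by move: alk; rewrite ali mem_tnth.
  have ialk : (index al (level D k) < levelsz D k)%N by rewrite index_mem.
  have ali : lidx (Ordinal ialk) = al by rewrite /lidx (tnth_nth 0) /= nth_index.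
  rewrite (bigD1 (Ordinal ialk)) //= ali eqxx big1 ?addr0 // => i ii.
  case: eqP => [ali'|_]; last by rewrite mul0r.
  by move: ii; rewrite -(inj_eq (@lidx_inj D k)) ali -ali' eqxx.
under eq_bigr do rewrite inner.
rewrite (bigD1 (Ordinal aln)) //= eqxx mul1r big1 ?addr0 // => k kal.
by rewrite [_ == _](negbTE _) ?mul0r // eq_sym; apply: contraNneq kal => kal; apply/eqP/val_inj.
Qed.

Lemma gram_intertwines t a :
  intertwines (@Upsilon R D a) (gram mu t)
    (fun k l => \matrix_(i, j) moment t (lidx i + svec a) (lidx j)).
Proof.
split=> [|n k l kn|n k l ln]; first exact: Upsilon_banded.
  apply/matrixP => i j; rewrite /bmul summxE mxE.
  rewrite -[RHS](sum_lidx (n := n) (fun al => moment t al (lidx j))).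
    apply: eq_bigr => m _; rewrite mxE; apply: eq_bigr => p _.
    by rewrite UpsilonE mxE.
  by have := mlen_svec (lidx i) a; rewrite mlen_lidx; lia.
apply/matrixP => i j; rewrite /bmul summxE mxE moment_shift.
rewrite -[RHS](sum_lidx (n := n) (fun be => moment t (lidx i) be)).
  apply: eq_bigr => m _; rewrite mxE; apply: eq_bigr => p _.
  by rewrite UpsilonE mxE mulrC subr_eq eq_sym.
by have := mlen_svec (lidx j - svec a) a; rewrite subrK mlen_lidx; lia.
Qed.

Lemma is_tderive_gram t a k l : deformable mu t ->
  is_tderive (svec a) (fun u => gram mu u k l) t
    (\matrix_(i, j) moment t (lidx i + svec a) (lidx j)).
Proof.
move=> dt; apply/is_tderiveP => i j; rewrite mxE.
by apply: eq_is_derive (is_derive_moment (lidx i) (lidx j) (svec a) dt) => s; rewrite mxE.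
Qed.

End Gram.

(** * The Toda flow *)

Section TodaFlow.
Variables (R : realType) (D : nat).
Implicit Types (t u : times R D) (a b : sindex D).

Lemma tderivableB al m n (F G : times R D -> 'M[R[i]]_(m, n)) t :
  tderivable al F t -> tderivable al G t -> tderivable al (fun u => F u - G u) t.
Proof. by move=> dF dG; case: (is_tderiveB (tderivableP dF) (tderivableP dG)). Qed.

Lemma tderivableM al m n p (F : times R D -> 'M[R[i]]_(m, n))
    (G : times R D -> 'M[R[i]]_(n, p)) t :
  tderivable al F t -> tderivable al G t -> tderivable al (fun u => F u *m G u) t.
Proof. by move=> dF dG; case: (is_tderiveM (tderivableP dF) (tderivableP dG)). Qed.

Lemma tderivable_sum al m n p (F : 'I_p -> times R D -> 'M[R[i]]_(m, n)) t :
  (forall i, tderivable al (F i) t) -> tderivable al (fun u => \sum_(i < p) F i u) t.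
Proof. by move=> dF; case: (is_tderive_sum (fun i => tderivableP (dF i))). Qed.

Lemma Upsilon_comm a b n k l : (k.+1 < n)%N ->
  bmul n (@Upsilon R D a) (@Upsilon R D b) k l = bmul n (@Upsilon R D b) (@Upsilon R D a) k l.
Proof.
move=> kn; apply/matrixP => i j.
have E c e : bmul n (@Upsilon R D c) (@Upsilon R D e) k l i j
    = (lidx i + svec c + svec e == lidx j)%:R.
  rewrite /bmul summxE -[RHS](sum_lidx (n := n) (fun al => (al + svec e == lidx j)%:R)).
    apply: eq_bigr => m _; rewrite mxE; apply: eq_bigr => p _.
    by rewrite !UpsilonE.
  by have := mlen_svec (lidx i) c; rewrite mlen_lidx; lia.
by rewrite !E addrAC.
Qed.

(** The moment matrix, the domain and the directions stay abstract because the flow is used twice: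
    for [gram mu] along [svec a], and for its adjoint in the conjugate times along
    [svec (sopp a)]. *)
Variables (G S Sh : times R D -> bmx R D).
Variable H : times R D -> forall k, 'M[R[i]]_(levelsz D k).
Variables (Omega : set (times R D)) (dir : sindex D -> midx D).
Variable dG : sindex D -> times R D -> bmx R D.
Hypothesis GB : forall t, Omega t -> gauss_borel (G t) (S t) (H t) (Sh t).
Hypothesis Omega_open : forall t a, Omega t ->
  \forall s \near (0 : R[i]^o), Omega (tshift t (dir a) s).
Hypothesis dG_intertwines : forall t a, Omega t ->
  intertwines (@Upsilon R D a) (G t) (dG a t).
Hypothesis G_deriv : forall t a k l, Omega t ->
  is_tderive (dir a) (fun u => G u k l) t (dG a t k l).

Let SHG t : Omega t -> orthogonalizes (S t) (H t) (G t).
Proof. by move=> /GB /gauss_borel_orthogonalizes. Qed.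

(** Identities known only on [Omega] may be differentiated, since [Omega] contains a neighbourhood
    of [t] in each coordinate slice. *)
Lemma Omega_is_tderive a m n (F F' : times R D -> 'M[R[i]]_(m, n)) t dF :
  Omega t -> (forall u, Omega u -> F u = F' u) ->
  is_tderive (dir a) F t dF -> is_tderive (dir a) F' t dF.
Proof.
move=> Ot FF; apply: near_is_tderive.
by apply: filterS (Omega_open a Ot) => s; exact: FF.
Qed.

Lemma Omega_tderivable a m n (F F' : times R D -> 'M[R[i]]_(m, n)) t :
  Omega t -> (forall u, Omega u -> F u = F' u) ->
  tderivable (dir a) F t -> tderivable (dir a) F' t.
Proof. by move=> Ot FF dF; case: (Omega_is_tderive Ot FF (tderivableP dF)). Qed.

Lemma H_unit t k : Omega t -> H t k \in unitmx.
Proof. by move=> /SHG[]. Qed.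

Lemma tderivable_invH a k t : Omega t -> tderivable (dir a) (fun u => H u k) t ->
  tderivable (dir a) (fun u => invmx (H u k)) t.
Proof.
move=> Ot dH; have nearU : \forall s \near (0 : R[i]^o), H (tshift t (dir a) s) k \in unitmx.
  by apply: filterS (Omega_open a Ot) => s; exact: H_unit.
by case: (is_tderiveV nearU (tderivableP dH)).
Qed.

(* The Gram-Schmidt recursion expresses each row of [S] and each column of
   [Sh^dagger] rationally through [G] and the previous ones. *)
Lemma tderivable_factors t a k : Omega t ->
  [/\ forall j, tderivable (dir a) (fun u => S u k j) t,
      forall j, tderivable (dir a) (fun u => adjmx (Sh u k j)) t
    & tderivable (dir a) (fun u => H u k) t].
Proof.
move=> Ot; elim/ltn_ind: k => k IH.
have GD i j : tderivable (dir a) (fun u => G u i j) t by case: (G_deriv a i j Ot).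
have SD j : tderivable (dir a) (fun u => S u k j) t.
  apply: (Omega_tderivable (F := fun u => @bmx1 R D k j - \sum_(i < k)
    (\sum_(m < i.+1) G u k m *m adjmx (Sh u i m)) *m invmx (H u i) *m S u i j) Ot).
    by move=> u /GB hu; rewrite [RHS](gauss_borel_rec _ _ hu).
  apply: tderivableB; first by case: (is_tderive_cst (dir a) (@bmx1 R D k j) t).
  apply: tderivable_sum => i; have [SDi ShDi HDi] := IH _ (ltn_ord i).
  apply: tderivableM => //; apply: tderivableM; last exact: tderivable_invH.
  by apply: tderivable_sum => m; exact: tderivableM.
(* The recursion for the adjoint factorization, conjugated back, involves [adjmx (Sh u i j)] and not
   [Sh] itself. *)
have ShD j : tderivable (dir a) (fun u => adjmx (Sh u k j)) t.
  apply: (Omega_tderivable (F := fun u => adjmx (@bmx1 R D k j) - \sum_(i < k)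
    adjmx (Sh u i j) *m (invmx (H u i) *m \sum_(m < i.+1) S u i m *m G u m k)) Ot).
    move=> u Ou; have hu := gauss_borel_adj (GB Ou).
    rewrite [in RHS](gauss_borel_rec _ _ hu) adjmxB adjmx_sum; congr (_ - _).
    apply: eq_bigr => i _; rewrite !adjmxM adjmx_sum adjmx_inv adjmxK.
    congr (_ *m (_ *m _)).
    by apply: eq_bigr => m _; rewrite adjmxM !adjmxK.
  apply: tderivableB; first by case: (is_tderive_cst (dir a) (adjmx (@bmx1 R D k j)) t).
  apply: tderivable_sum => i; have [SDi ShDi HDi] := IH _ (ltn_ord i).
  apply: tderivableM => //; apply: tderivableM; first exact: tderivable_invH.
  by apply: tderivable_sum => m; exact: tderivableM.
split=> //.
apply: (Omega_tderivable (F := fun u => bmul k.+1 (S u) (G u) k k) Ot).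
  by move=> u /SHG[_ _ _ _]; exact.
by apply: tderivable_sum => m; exact: tderivableM.
Qed.

(** The triangular shape of [S], the zeros of [S G] below the diagonal and its diagonal [H] hold on
    all of [Omega]; differentiating them yields the hypotheses of [toda_first_order]. *)
Lemma first_order_flow t a : Omega t ->
  (forall k j, is_tderive (dir a) (fun u => S u k j) t
     (- lowrow (S t) (H t) (@Upsilon R D a) k j)) /\
  (forall k, is_tderive (dir a) (fun u => H u k) t
     (diagcoef (S t) (@Upsilon R D a) k *m H t k)).
Proof.
move=> Ot.
pose X k j := tderive (dir a) (fun u => S u k j) t.
pose K k := tderive (dir a) (fun u => H u k) t.
have SX k j : is_tderive (dir a) (fun u => S u k j) t (X k j).
  by apply: tderivableP; case: (tderivable_factors a k Ot).
have HK k : is_tderive (dir a) (fun u => H u k) t (K k).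
  by apply: tderivableP; case: (tderivable_factors a k Ot).
have SGX n k l : is_tderive (dir a) (fun u => bmul n (S u) (G u) k l) t
    (bmul n X (G t) k l + bmul n (S t) (dG a t) k l).
  rewrite /bmul -big_split /=; apply: is_tderive_sum => j.
  by apply: is_tderiveM => //; exact: G_deriv.
have uniq m n (F : times R D -> 'M[R[i]]_(m, n)) A B :
    is_tderive (dir a) F t A -> is_tderive (dir a) F t B -> A = B.
  by move=> [_ <-] [_ <-].
have [XE KE] : (forall k j, X k j = - lowrow (S t) (H t) (@Upsilon R D a) k j) /\
    (forall k, K k = diagcoef (S t) (@Upsilon R D a) k *m H t k).
  apply: (toda_first_order (SHG Ot) (dG_intertwines a Ot)).
  - move=> k j; rewrite leq_eqVlt => /orP[/eqP <- | kj]; apply: uniq (SX _ _) _.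
      apply: Omega_is_tderive Ot _ (is_tderive_cst _ 1%:M t).
      by move=> u /SHG[_ + _ _ _].
    apply: Omega_is_tderive Ot _ (is_tderive_cst _ 0 t).
    by move=> u /SHG[+ _ _ _ _] => ->.
  - move=> n k l kn lk; apply: uniq (SGX _ _ _) _.
    apply: Omega_is_tderive Ot _ (is_tderive_cst _ 0 t).
    by move=> u /SHG[_ _ _ + _] => ->.
  - move=> n k kn; apply: uniq (SGX _ _ _) _.
    apply: Omega_is_tderive Ot _ (HK k).
    by move=> u /SHG[_ _ _ _] ->.
by split=> [k j|k]; rewrite -?XE -?KE.
Qed.

Local Notation Up a := (@Upsilon R D a).

(** On [Omega] the logarithmic derivative of [H k] is [diagcoef], which is affine in subdiagonal
    blocks of [S]; the first-order flow differentiates these. *)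
Lemma toda_H_flow t a b k : Omega t ->
  let dH u := tderive (dir a) (fun v => H v k) u *m invmx (H u k) in
  tderivable (dir a) (fun u => H u k) t /\
  is_tderive (dir b) dH t
    (Up a k k.+1 *m H t k.+1 *m Up b k.+1 k *m invmx (H t k)
     - match k return 'M[R[i]]_(levelsz D k) with
       | 0%N => 0
       | j.+1 => H t j.+1 *m Up b j.+1 j *m invmx (H t j) *m Up a j j.+1
       end).
Proof.
move=> Ot dH; split; first by case: (tderivable_factors a k Ot).
apply: (Omega_is_tderive (F := fun u => diagcoef (S u) (Up a) k) Ot).
  move=> u Ou; rewrite /dH; have [_ /(_ k)[_ ->]] := first_order_flow a Ou.
  by rewrite mulmxK // H_unit.
have [dS _] := first_order_flow b Ot.
have Sd j : S t j j = 1%:M by case: (SHG Ot).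
rewrite addrC -[X in _ + X]opprK; apply: is_tderiveB.
  case: k @dH => [|p] _; first by rewrite oppr0; exact: is_tderive_cst.
  have := is_tderiveM (dS p.+1 p) (is_tderive_cst (dir b) (Up a p p.+1) t).
  by rewrite mulmx0 addr0 mulNmx /= /lowcoef Sd mulmx1.
have := is_tderiveM (is_tderive_cst (dir b) (Up a k k.+1) t) (dS k.+1 k).
by rewrite mul0mx add0r mulmxN /= /lowcoef Sd mulmx1 !mulmxA.
Qed.

(** Differentiating [- lowcoef] through the flow of [H] gives a commutator-like expression, low
    coefficients in [b] and diagonal ones in [a]. The right-hand side is the same expression with
    [a] and [b] exchanged, and [toda_symmetry] identifies the two. *)
Lemma toda_beta_flow t a b k : Omega t ->
  let beta u := S u k.+1 k in
  let quad u := beta u *m Up b k k.+1 *m beta u in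
  [/\ tderivable (dir a) beta t, tderivable (dir b) beta t,
      tderivable (dir a) (tderive (dir b) beta) t, tderivable (dir a) quad t
    & tderive (dir a) (tderive (dir b) beta) t =
        tderive (dir a) quad t
        - tderive (dir a) beta t *m
            match k return 'M[R[i]]_(levelsz D k) with
            | 0%N => 0
            | j.+1 => S t j.+1 j *m Up b j j.+1
            end
        - Up b k.+1 k.+2 *m S t k.+2 k.+1 *m tderive (dir a) beta t].
Proof.
move=> Ot beta quad.
have dbeta u c : Omega u -> is_tderive (dir c) beta u (- lowcoef (H u) (Up c) k).
  move=> Ou; have [/(_ k.+1 k) + _] := first_order_flow c Ou.
  by rewrite /= (_ : S u k k = 1%:M) ?mulmx1 //; case: (SHG Ou).
have [_ dH] := first_order_flow a Ot.
have uHk : H t k \in unitmx by exact: H_unit.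
have nearU : \forall s \near (0 : R[i]^o), H (tshift t (dir a) s) k \in unitmx.
  by apply: filterS (Omega_open a Ot) => s; exact: H_unit.
have ddbeta : is_tderive (dir a) (tderive (dir b) beta) t
    (lowcoef (H t) (Up b) k *m diagcoef (S t) (Up a) k
     - diagcoef (S t) (Up a) k.+1 *m lowcoef (H t) (Up b) k).
  apply: (Omega_is_tderive (F := fun u => - lowcoef (H u) (Up b) k) Ot).
    by move=> u Ou; case: (dbeta u b Ou).
  have := is_tderiveN (is_tderiveM (is_tderiveM (dH k.+1)
    (is_tderive_cst (dir a) (Up b k.+1 k) t)) (is_tderiveV nearU (dH k))).
  rewrite /lowcoef; move: (diagcoef _ _ k) (diagcoef _ _ k.+1) => A A'.
  rewrite mulmx0 addr0 mulmxN opprD opprK addrC.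
  rewrite (mulmxA (invmx _) A) (mulmxK uHk).
  by rewrite (mulmxA _ (invmx _) A) (mulmxA A') (mulmxA A').
have dquad := is_tderiveM (is_tderiveM (dbeta t a Ot)
  (is_tderive_cst (dir a) (Up b k k.+1) t)) (dbeta t a Ot).
have [d1 e1] := dbeta t a Ot; have [d2 _] := dbeta t b Ot.
have [d3 e3] := ddbeta; have [d4 e4] := dquad.
split; [exact: d1|exact: d2|exact: d3|exact: d4|].
rewrite e3 e4 e1 mulmx0 addr0.
have sym := toda_symmetry (SHG Ot) k (dG_intertwines a Ot) (dG_intertwines b Ot)
  (@Upsilon_comm a b).
have {sym} -> : lowcoef (H t) (Up b) k *m diagcoef (S t) (Up a) k
      - diagcoef (S t) (Up a) k.+1 *m lowcoef (H t) (Up b) k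
    = lowcoef (H t) (Up a) k *m diagcoef (S t) (Up b) k
      - diagcoef (S t) (Up b) k.+1 *m lowcoef (H t) (Up a) k.
  by apply/eqP; rewrite subr_eq addrAC eq_sym subr_eq addrC sym addrC.
(* The two diagonal coefficients unfold into four products: two form the derivative of [quad], the
   other two are the remaining terms of the equation. *)
rewrite /diagcoef -/(beta t).
move: (lowcoef _ _ _) (beta t) (Up b k k.+1) (match k with 0 => _ | _ => _ end)
  (Up b k.+1 k.+2 *m _) => L be U M V.
rewrite !(mulmxBr, mulmxBl, mulNmx, mulmxN) !mulmxA !opprK opprB.
by rewrite [LHS](AC (2*2) (2*4*1*3)).
Qed.

End TodaFlow.

(** * Conjugate times *)

Section ConjugateTimes.
Variables (R : realType) (D : nat).
Local Notation C := R[i]^o.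

Lemma near_conj (P : set C) :
  (\forall h \near (0 : C), P h) -> \forall h \near (0 : C), P ((h : R[i])^* : C).
Proof.
move=> /nbhs_ballP[e /= e0 eP]; apply/nbhs_ballP; exists e => //= h.
rewrite -ball_normE /= sub0r normrN => he; apply: eP.
by rewrite -ball_normE /= sub0r normrN norm_conjC.
Qed.

(** The difference quotient of [g] at [h] is the conjugate of that of [f] at the conjugate of [h],
    and conjugation is an isometry. *)
Lemma is_derive_conj (f : C -> C) (d : C) :
  is_derive (0 : C) (1 : C) f d ->
  is_derive (0 : C) (1 : C) ((fun s => (f ((s : R[i])^* : C) : R[i])^*) : C -> C)
    ((d : R[i])^* : C).
Proof.
move=> [df dE].
set g := (fun s => _) : C -> C.
have cf : (fun h : C => (h : R[i])^-1 *: ((f \o shift 0) ((h : R[i]) *: 1) - f 0))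
    @ (0 : C)^' --> d by rewrite -dE; exact: df.
suff cg : (fun h : C => (h : R[i])^-1 *: ((g \o shift 0) ((h : R[i]) *: 1) - g 0))
    @ (0 : C)^' --> ((d : R[i])^* : C).
  by apply: DeriveDef; [exact: cvgP cg | exact: cvg_lim cg].
apply/cvgrPdist_le => eps eps0.
move/cvgrPdist_le : cf => /(_ eps eps0) cf.
have := near_conj cf; apply: filterS => h /= fh hn0.
have /fh : (h : R[i])^* != 0 by rewrite conjC_eq0.
rewrite /g /GRing.scale /= !mulr1 !addr0 conjC0 -[X in X <= _ -> _]norm_conjC.
by rewrite rmorphB rmorphM fmorphV rmorphB /= conjCK.
Qed.

Lemma tconjK (t : times R D) : tconj (tconj t) = t.
Proof. by apply/funext => al; rewrite /tconj conjCK. Qed.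

Lemma tconj_tshift (t : times R D) al s : tconj (tshift t al s) = tshift (tconj t) al s^*.
Proof.
apply/funext => be; rewrite /tconj /tshift rmorphD /=.
by case: ifP => // _; rewrite conjC0.
Qed.

Lemma is_tderive_conj m n al (F : times R D -> 'M[R[i]]_(m, n)) t dF :
  is_tderive al F (tconj t) dF ->
  is_tderive al (fun u => adjmx (F (tconj u))) t (adjmx dF).
Proof.
move=> /is_tderiveP dFF; apply/is_tderiveP => i j; rewrite mxE.
apply: eq_is_derive (is_derive_conj (dFF j i)) => s.
by rewrite mxE tconj_tshift.
Qed.

Lemma adj_Upsilon (a : sindex D) k l :
  adjmx (Upsilon R a k l) = Upsilon R (sopp a) l k.
Proof.
apply/matrixP => i j; rewrite mxE !UpsilonE.
have -> : svec (sopp a) = - svec a.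
  by rewrite /svec /sopp /=; case: a.2; rewrite //= opprK.
by rewrite conjC_nat subr_eq eq_sym.
Qed.

(** The adjoint exchanges the two sides of multiplication and turns [Upsilon] at [sopp a] into
    [Upsilon] at [a]; hence the opposite times in the hatted equation. *)
Lemma intertwines_adj (a : sindex D) (G dG : bmx R D) :
  intertwines (@Upsilon R D (sopp a)) G dG ->
  intertwines (@Upsilon R D a) (badj G) (badj dG).
Proof.
have aa : sopp (sopp a) = a by rewrite /sopp /= negbK; case: a.
move=> [_ UG GU]; split=> [|n k l kn|n k l ln]; first exact: Upsilon_banded.
  rewrite /badj -(GU n l k kn) adjmx_sum; apply: eq_bigr => j _.
  by rewrite adjmxM adj_Upsilon aa.
rewrite /badj -(UG n l k ln) adjmx_sum; apply: eq_bigr => j _.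
by rewrite adjmxM adj_Upsilon aa.
Qed.

End ConjugateTimes.

Theorem theorem4p2 (R : realType) (D : nat) (hD : (0 < D)%N)
    (mu : {charge set (btorus R D) -> \bar R[i]})
    (S Sh : times R D -> bmx R D)
    (H : times R D -> forall k, 'M[R[i]]_(levelsz D k))
    (hfact : forall t, admissible mu t ->
      gauss_borel (gram mu t) (S t) (H t) (Sh t))
    (Omega : set (times R D))
    (hadm : forall t, Omega t -> admissible mu t)
    (hopen : forall (t : times R D) (a : sindex D), Omega t ->
      \forall s \near (0 : R[i]^o), Omega (tshift t (svec a) s)) :
  forall (t : times R D) (a b : sindex D) (k : nat), Omega t ->
  [/\
    (* H_{[k]} *)
    let dH u := tderive (svec a) (fun v => H v k) u *m invmx (H u k) in
    [/\ tderivable (svec a) (fun u => H u k) t,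
        tderivable (svec b) dH t
      & tderive (svec b) dH t =
          Upsilon R a k k.+1 *m H t k.+1 *m Upsilon R b k.+1 k *m invmx (H t k)
          - match k return 'M[R[i]]_(levelsz D k) with
            | 0%N => 0
            | j.+1 => H t j.+1 *m Upsilon R b j.+1 j
                        *m invmx (H t j) *m Upsilon R a j j.+1
            end],
    (* beta_{[k+1]} *)
    let beta u := S u k.+1 k in
    let quad u := beta u *m Upsilon R b k k.+1 *m beta u in
    [/\ tderivable (svec a) beta t,
        tderivable (svec b) beta t,
        tderivable (svec a) (tderive (svec b) beta) t,
        tderivable (svec a) quad t
      & tderive (svec a) (tderive (svec b) beta) t =
          tderive (svec a) quad t
          - tderive (svec a) beta t *m
              match k return 'M[R[i]]_(levelsz D k) with
              | 0%N => 0
              | j.+1 => S t j.+1 j *m Upsilon R b j j.+1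
              end
          - Upsilon R b k.+1 k.+2 *m S t k.+2 k.+1
              *m tderive (svec a) beta t]
    (* hat beta_{[k+1]} *)
  & let hbeta u := Sh u k.+1 k in
    let hquad u := hbeta u *m Upsilon R b k k.+1 *m hbeta u in
    let na := svec (sopp a) in
    let nb := svec (sopp b) in
    [/\ cderivable na hbeta t,
        cderivable nb hbeta t,
        cderivable na (cderive nb hbeta) t,
        cderivable na hquad t
      & cderive na (cderive nb hbeta) t =
          cderive na hquad t
          - cderive na hbeta t *m
              match k return 'M[R[i]]_(levelsz D k) with
              | 0%N => 0
              | j.+1 => Sh t j.+1 j *m Upsilon R b j j.+1
              end
          - Upsilon R b k.+1 k.+2 *m Sh t k.+2 k.+1
              *m cderive na hbeta t]].
Proof.
move=> t a b k Ot.
have GB u : Omega u -> gauss_borel (gram mu u) (S u) (H u) (Sh u).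
  by move=> /hadm /hfact.
have deform u : Omega u -> deformable mu u by move=> /hadm[].
pose dgram c u : bmx R D :=
  fun k l => \matrix_(i, j) moment mu u (lidx i + svec c) (lidx j).
have dgram_tw u c : Omega u -> intertwines (@Upsilon R D c) (gram mu u) (dgram c u).
  by move=> _; exact: gram_intertwines.
have dgram_der u c m n : Omega u ->
    is_tderive (svec c) (fun v => gram mu v m n) u (dgram c u m n).
  by move=> /deform; exact: is_tderive_gram.
split.
- have [dH [ddH eH]] := toda_H_flow GB hopen dgram_tw dgram_der a b k Ot.
  by split; [exact: dH | exact: ddH | exact: eH].
- exact: (toda_beta_flow GB hopen dgram_tw dgram_der a b k Ot).
have GBc u : Omega (tconj u) -> gauss_borel (badj (gram mu (tconj u)))
    (Sh (tconj u)) (fun k => adjmx (H (tconj u) k)) (S (tconj u)).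
  by move=> /GB; exact: gauss_borel_adj.
have openc u c : Omega (tconj u) ->
    \forall s \near (0 : R[i]^o), Omega (tconj (tshift u (svec (sopp c)) s)).
  move=> /(hopen _ (sopp c)) /near_conj; apply: filterS => s.
  by rewrite tconj_tshift.
(* [cderive] at [t] evaluates at [tconj t], where the domain of the conjugate flow is [Omega]
   composed with [tconj]. *)
have Otc : Omega (tconj (tconj t)) by rewrite tconjK.
have [d1 d2 d3 d4 eqn] := @toda_beta_flow _ _ (fun u => badj (gram mu (tconj u))) (Sh \o @tconj R D)
  (S \o @tconj R D) (fun u k => adjmx (H (tconj u) k)) (Omega \o @tconj R D)
  (fun c => svec (sopp c)) (fun c u => badj (dgram (sopp c) (tconj u))) GBc openc
  (fun u c Ou => intertwines_adj (dgram_tw _ (sopp c) Ou))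
  (fun u c m n Ou => is_tderive_conj (dgram_der _ (sopp c) n m Ou))
  (tconj t) a b k Otc.
move=> hbeta hquad na nb.
(* In an iterated [cderive] the inner conjugation cancels the outer one, leaving ordinary iterated
   derivatives in the conjugate times. *)
have conj_tderive : cderive nb hbeta \o @tconj R D = tderive nb (hbeta \o @tconj R D).
  by apply/funext => u; rewrite /cderive /= tconjK.
split; [exact: d1 | exact: d2 | | exact: d4 |].
  by rewrite /cderivable conj_tderive; exact: d3.
have -> : Sh t = (Sh \o @tconj R D) (tconj t) by rewrite /= tconjK.
have lhsE : cderive na (cderive nb hbeta) t
    = tderive na (tderive nb (hbeta \o @tconj R D)) (tconj t).
  by rewrite -conj_tderive.
rewrite lhsE.
exact: eqn.
Qed.
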